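(* Let $N$ be a semi-invariant submanifold of a nondegenerate $(g,F,\mu)$-manifold $M$ with parallel tensor field $F$. Let $D$ and $D^{\perp}$ be the $F$-invariant and $F$-anti-invariant distributions of $N$, and let $\widetilde D$ be the orthogonal complement of $F(D^{\perp})$ in the normal bundle $T^{\perp}N$. Then the following assertions are equivalent: (i) The $F$-anti-invariant foliation (the foliation of $N$ defined by $D^\perp$) is totally geodesic; that is, $\nabla_YZ\in\Gamma(D^{\perp})$ for all $Y,Z\in\Gamma(D^{\perp})$, where $\nabla$ is the Levi-Civita connection of $N$. (ii) The second fundamental form $h$ of $N$ satisfies $h(X,Y)\in\Gamma(\widetilde D)$ for all $X\in\Gamma(D)$ and $Y\in\Gamma(D^{\perp})$. (iii) $D^{\perp}$ is $A_V$-invariant for every $V\in\Gamma(F(D^{\perp}))$, that is, $A_VY\in\Gamma(D^{\perp})$ for all $Y\in\Gamma(D^{\perp})$.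
   Context: All objects are smooth; $\Gamma(V)$ denotes the smooth sections of a vector bundle $V$. Fix $\mu\in\{-1,+1\}$. A $(g,F,\mu)$-manifold is a manifold $M$ with a Riemannian metric $g$ and a $(1,1)$-tensor field $F$ such that $g(FX,Y)+\mu g(X,FY)=0$ for all vector fields $X,Y$ on $M$. It is nondegenerate if $F_x:T_xM\to T_xM$ is nondegenerate (invertible) at every $x\in M$. $F$ is parallel if $\widetilde\nabla F=0$, where $\widetilde\nabla$ is the Levi-Civita connection of $(M,g)$. A submanifold $N$ of $M$ (with induced metric, also denoted $g$, and normal bundle $T^{\perp}N$) is semi-invariant if there is a distribution $D$ on $N$ such that: (i) $F(D_x)\subset D_x$ for all $x\in N$; (ii) the orthogonal complement $D^{\perp}$ of $D$ in $TN$ satisfies $F(D^{\perp}_x)\subset T^{\perp}_xN$ for all $x\in N$; (iii) $F^2(D^{\perp})$ is a distribution on $N$ (a subbundle of $TN$). The second fundamental form $h$ and the Weingarten operators $A_V$ of $N$ are given by $\widetilde\nabla_XY=\nabla_XY+h(X,Y)$ and $\widetilde\nabla_XV=-A_VX+\nabla^{\perp}_XV$ for $X,Y\in\Gamma(TN)$, $V\in\Gamma(T^{\perp}N)$, where $\nabla$ is the Levi-Civita connection of $N$ and $\nabla^\perp$ the normal connection; they satisfy $g(h(X,Y),V)=g(A_VX,Y)$. A foliation of $N$ is totally geodesic if each of its leaves is totally geodesically immersed in $N$; the foliation defined by $D^\perp$ is totally geodesic if and only if $\nabla_YZ\in\Gamma(D^\perp)$ for all $Y,Z\in\Gamma(D^\perp)$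 (this condition in itself forces $D^\perp$ to be integrable). *)

(* Defs.v *)
From HB Require Import structures.
From mathcomp Require Import all_boot all_order all_algebra.
From mathcomp Require Import all_classical all_reals all_analysis.

Set Implicit Arguments.
Unset Strict Implicit.
Unset Printing Implicit Defensive.

Import Order.TTheory GRing.Theory Num.Theory.
Import numFieldNormedType.Exports.

Local Open Scope classical_set_scope.
Local Open Scope ring_scope.

Section SmoothFunctions.
Context (R : realType) (V W : normedModType R).

(* Meant for open U only: the derivatives are taken in the full space V. *)
Fixpoint Ck_on (k : nat) (U : set V) (f : V -> W) : Prop :=
  if k is k'.+1 then
    (forall p, U p -> differentiable f p) /\
    (forall v, Ck_on k' U (fun p => 'D_v f p))
  else forall p, U p -> {for p, continuous f}.

Definition smooth_on (U : set V) (f : V -> W) : Prop :=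
  forall k, Ck_on k U f.

End SmoothFunctions.

(* A smooth structure is given by a (not necessarily maximal) smooth atlas; the
   notions of smoothness used below depend only on the maximal atlas it
   generates.

   [chart_at x] is a chosen chart around x. It serves to represent the tangent
   space T_x M by the space of row vectors 'rV[R]_n: a tangent vector at x is
   represented by its components in the chart [chart_at x], and its components
   in any other chart around x are obtained by the Jacobian of the change of
   charts. Accordingly, linear maps act on the right ([u *m A]), subspaces of
   T_x M are row spaces of matrices, and a field of k-tuples of tangent vectors
   is a function X : M -> 'M[R]_(k, n) (k = 1 for vector fields). *)
Record manifold (R : realType) (n : nat) := Manifold {
  mcarrier :> topologicalType;
  mhausdorff : hausdorff_space mcarrier;
  msecond_countable : @second_countable mcarrier;
  chart_index : Type;
  dom : chart_index -> set mcarrier;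
  chart : chart_index -> mcarrier -> 'rV[R]_n;
  param : chart_index -> 'rV[R]_n -> mcarrier;
  chart_at : mcarrier -> chart_index;
  chart_atP : forall x, dom (chart_at x) x;
  dom_open : forall i, open (dom i);
  chart_open : forall i, open (chart i @` dom i);
  chartK : forall i, {in dom i, cancel (chart i) (param i)};
  chart_continuous : forall i x, dom i x -> {for x, continuous (chart i)};
  param_continuous : forall i p, (chart i @` dom i) p ->
    {for p, continuous (param i)};
  transition_smooth : forall i j,
    smooth_on (chart i @` (dom i `&` dom j)) (chart j \o param i) }.

Arguments chart_index {R n} _.
Arguments dom {R n _} _.
Arguments chart {R n _} _.
Arguments param {R n _} _.
Arguments chart_at {R n _} _.

Section Tensors.
Context (R : realType) (n : nat) (M : manifold R n).
Implicit Types (i j : chart_index M) (x : M) (p : 'rV[R]_n).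

Definition chart_image i : set 'rV[R]_n := chart i @` dom i.

Definition transition_jac i j x : 'M[R]_n :=
  'J (chart j \o param i) (chart i x).

(* from the representation of T_x M to components in the chart i, and back *)
Definition to_chart i x : 'M[R]_n := transition_jac (chart_at x) i x.
Definition of_chart i x : 'M[R]_n := transition_jac i (chart_at x) x.

Definition ip (G : 'M[R]_n) (u v : 'rV[R]_n) : R := (u *m G *m v^T) 0 0.

(* Expressions in the chart i, as functions of the coordinates, of a field of
   k-tuples of tangent vectors, of a (0,2)-tensor field given by its Gram
   matrices, and of a (1,1)-tensor field. *)
Definition field_in k i (X : M -> 'M[R]_(k, n)) p : 'M[R]_(k, n) :=
  X (param i p) *m to_chart i (param i p).
Definition form_in i (g : M -> 'M[R]_n) p : 'M[R]_n :=
  of_chart i (param i p) *m g (param i p) *m (of_chart i (param i p))^T.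
Definition endo_in i (F : M -> 'M[R]_n) p : 'M[R]_n :=
  of_chart i (param i p) *m F (param i p) *m to_chart i (param i p).

Definition smooth_field_on k (U : set M) (X : M -> 'M[R]_(k, n)) : Prop :=
  forall i, smooth_on (chart i @` (dom i `&` U)) (field_in i X).

Definition smooth_field (X : M -> 'rV[R]_n) : Prop := smooth_field_on setT X.

Definition smooth_form (g : M -> 'M[R]_n) : Prop :=
  forall i, smooth_on (chart_image i) (form_in i g).

Definition smooth_endo (F : M -> 'M[R]_n) : Prop :=
  forall i, smooth_on (chart_image i) (endo_in i F).

Definition riemannian_metric (g : M -> 'M[R]_n) : Prop :=
  [/\ smooth_form g,
      forall x u v, ip (g x) u v = ip (g x) v u &
      forall x u, u != 0 -> 0 < ip (g x) u u].

(* Smooth subbundles of the tangent bundle, as row spaces; the rank is locally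
   constant, hence constant when the manifold is connected. *)
Definition tangent_distribution (D : M -> 'M[R]_n) : Prop :=
  forall x, exists (k : nat) (U : set M) (E : M -> 'M[R]_(k, n)),
    [/\ open U, U x, smooth_field_on U E &
        forall y, U y -> row_free (E y) /\ (E y == D y)%MS].

Definition section_of (D : M -> 'M[R]_n) (X : M -> 'rV[R]_n) : Prop :=
  smooth_field X /\ forall x, (X x <= D x)%MS.

(* [christoffel i p a b] is the vector of components, in the chart i, of the
   covariant derivative of the b-th coordinate field along the a-th one. *)
Definition christoffel_apply (G : 'I_n -> 'I_n -> 'rV[R]_n) (u v : 'rV[R]_n) :
    'rV[R]_n :=
  \sum_(a < n) \sum_(b < n) (u 0 a * v 0 b) *: G a b.

(* [christoffel_transition] says that the local covariant derivatives
   D_u Y + christoffel(u, Y) agree under changes of charts; the second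
   derivative of the change of charts comes from differentiating the
   components of Y in the new chart. *)
Record connection := Connection {
  christoffel : chart_index M -> 'rV[R]_n -> 'I_n -> 'I_n -> 'rV[R]_n;
  christoffel_smooth : forall i a b,
    smooth_on (chart_image i) (fun p => christoffel i p a b);
  christoffel_transition : forall i j x (u v : 'rV[R]_n),
    dom i x -> dom j x ->
    let t := chart j \o param i in
    let p := chart i x in
    christoffel_apply (christoffel j (t p)) (u *m 'J t p) (v *m 'J t p) +
      'D_u (fun q => 'D_v t q) p =
    christoffel_apply (christoffel i p) u v *m 'J t p }.

Implicit Types (nabla : connection) (X Y Z : 'rV[R]_n -> 'rV[R]_n).

Definition local_cov nabla i X Y p : 'rV[R]_n :=
  'D_(X p) Y p + christoffel_apply (christoffel nabla i p) (X p) (Y p).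

Definition cov nabla (X Y : M -> 'rV[R]_n) x : 'rV[R]_n :=
  let i := chart_at x in
  local_cov nabla i (field_in i X) (field_in i Y) (chart i x).

Definition local_lie X Y p : 'rV[R]_n := 'D_(X p) Y p - 'D_(Y p) X p.

(* The next three conditions are local and are therefore tested on the vector
   fields defined on the domain of a chart. *)
Definition torsion_free nabla : Prop :=
  forall i X Y, smooth_on (chart_image i) X -> smooth_on (chart_image i) Y ->
  forall p, chart_image i p ->
    local_cov nabla i X Y p - local_cov nabla i Y X p = local_lie X Y p.

Definition metric_compatible (g : M -> 'M[R]_n) nabla : Prop :=
  forall i X Y Z, smooth_on (chart_image i) X -> smooth_on (chart_image i) Y ->
    smooth_on (chart_image i) Z -> forall p, chart_image i p ->
    'D_(X p) (fun q => ip (form_in i g q) (Y q) (Z q) : R^o) p =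
      ip (form_in i g p) (local_cov nabla i X Y p) (Z p) +
      ip (form_in i g p) (Y p) (local_cov nabla i X Z p).

Definition parallel_endo nabla (F : M -> 'M[R]_n) : Prop :=
  forall i X Y, smooth_on (chart_image i) X -> smooth_on (chart_image i) Y ->
  forall p, chart_image i p ->
    local_cov nabla i X (fun q => Y q *m endo_in i F q) p =
    local_cov nabla i X Y p *m endo_in i F p.

Definition levi_civita (g : M -> 'M[R]_n) nabla : Prop :=
  torsion_free nabla /\ metric_compatible g nabla.

Definition gFmu_manifold (mu : R) (g F : M -> 'M[R]_n) : Prop :=
  [/\ riemannian_metric g, smooth_endo F &
      forall x u v, ip (g x) (u *m F x) v + mu * ip (g x) u (v *m F x) = 0].

Definition nondegenerate_endo (F : M -> 'M[R]_n) : Prop :=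
  forall x, F x \in unitmx.

End Tensors.

(* A submanifold of M is a manifold N with an immersion f : N -> M (an
   injective one, or an embedding, are special cases). *)
Section Submanifolds.
Context (R : realType) (n m : nat) (N : manifold R n) (M : manifold R m).
Implicit Types (f : N -> M) (x : N) (g F : M -> 'M[R]_m) (D : N -> 'M[R]_n).

Definition smooth_map f : Prop :=
  continuous f /\ forall (i : chart_index N) (j : chart_index M),
    smooth_on (chart i @` (dom i `&` f @^-1` dom j))
              (chart j \o f \o param i).

(* differential T_x N -> T_(f x) M *)
Definition differential f x : 'M[R]_(n, m) :=
  'J (chart (chart_at (f x)) \o f \o param (chart_at x)) (chart (chart_at x) x).

Definition immersion f : Prop :=
  smooth_map f /\ forall x, row_free (differential f x).

(* vector fields along f, i.e. sections V of f^* TM, V x in T_(f x) M;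
   j is a chart of M and i a chart of N *)
Definition along_in f (i : chart_index N) (j : chart_index M)
    (V : N -> 'rV[R]_m) (p : 'rV[R]_n) : 'rV[R]_m :=
  V (param i p) *m to_chart j (f (param i p)).

Definition smooth_along f (V : N -> 'rV[R]_m) : Prop :=
  forall (i : chart_index N) (j : chart_index M),
    smooth_on (chart i @` (dom i `&` f @^-1` dom j)) (along_in f i j V).

Definition section_along f k (E : N -> 'M[R]_(k, m)) (V : N -> 'rV[R]_m) :
    Prop :=
  smooth_along f V /\ forall x, (V x <= E x)%MS.

Definition push f (X : N -> 'rV[R]_n) x : 'rV[R]_m := X x *m differential f x.

(* covariant derivative of a vector field V along f *)
Definition cov_along f (nabla : connection M) (X : N -> 'rV[R]_n)
    (V : N -> 'rV[R]_m) x : 'rV[R]_m :=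
  let i := chart_at x in
  let j := chart_at (f x) in
  'D_(X x) (along_in f i j V) (chart i x) +
  christoffel_apply (christoffel nabla j (chart j (f x))) (push f X x) (V x).

Definition induced_metric f g x : 'M[R]_n :=
  differential f x *m g (f x) *m (differential f x)^T.

Definition normal_bundle f g x : 'M[R]_m :=
  kermx (g (f x) *m (differential f x)^T).

(* The tangential component of w in T_(f x) M: the unique t in T_x N such that
   w - t *m differential f x is normal. *)
Definition tangential f g x (w : 'rV[R]_m) : 'rV[R]_n :=
  w *m g (f x) *m (differential f x)^T *m invmx (induced_metric f g x).

Definition second_fundamental_form f (nablaM : connection M)
    (nablaN : connection N) (X Y : N -> 'rV[R]_n) x : 'rV[R]_m :=
  cov_along f nablaM X (push f Y) x - push f (cov nablaN X Y) x.

(* A_V X *)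
Definition weingarten f g (nablaM : connection M) (V : N -> 'rV[R]_m)
    (X : N -> 'rV[R]_n) x : 'rV[R]_n :=
  - tangential f g x (cov_along f nablaM X V x).

(* orthogonal complement of D in TN *)
Definition Dperp f g D x : 'M[R]_n := kermx (induced_metric f g x *m (D x)^T).

(* F(D) inside f^* TM *)
Definition F_image f F D x : 'M[R]_(n, m) :=
  D x *m differential f x *m F (f x).

Definition semi_invariant f g F D : Prop :=
  [/\ tangent_distribution D,
      forall x, (F_image f F D x <= D x *m differential f x)%MS,
      forall x, (F_image f F (Dperp f g D) x <= normal_bundle f g x)%MS &
      exists E : N -> 'M[R]_n, tangent_distribution E /\ forall x,
        (E x *m differential f x ==
         F_image f F (Dperp f g D) x *m F (f x))%MS].

(* orthogonal complement of F(D^perp) in the normal bundle *)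
Definition Dtilde f g F D x : 'M[R]_m :=
  (normal_bundle f g x :&:
   kermx (g (f x) *m (F_image f F (Dperp f g D) x)^T))%MS.

End Submanifolds.

(* Main.v *)
(** In an adapted chart the Christoffel transformation law makes the covariant
derivative along the immersion f : N -> M well defined, and there metric
compatibility and parallelism of F become product rules along f.  The normal
part h of the derivative of one tangent field along another is symmetric (no
torsion, and second derivatives commute), while g(h(X,Y),fZ) is skew in (Y,Z);
a trilinear form that is symmetric in its first two arguments and skew in its
last two vanishes, so h is normal, which is the Gauss formula.

For X in D and Y, Z in D^perp one then finds, since FZ is normal and F parallel,
  g(h(X,Y), FZ) = - g(X, F(nabla_Y Z)) = mu g(FX, nabla_Y Z),
where nabla_Y Z is taken in N because FX is tangent.  As F D = D, the left-hand
side vanishes for all X, Z exactly when nabla_Y Z is orthogonal to D.  Moreover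
g(A_V Y, X) = g(h(X,Y), V) for V in F(D^perp), which gives the equivalence with
the A_V-invariance of D^perp.  Passing from sections to vectors at a point uses
bump functions built from exp(-1/t). *)
Require Import Defs.
From HB Require Import structures.
From mathcomp Require Import all_boot all_order all_algebra.
From mathcomp Require Import all_classical all_reals all_analysis.
From mathcomp Require Import ring lra.
Import Order.TTheory GRing.Theory Num.Theory.
Import numFieldNormedType.Exports.
Local Open Scope classical_set_scope.
Local Open Scope ring_scope.

Set Implicit Arguments.
Unset Strict Implicit.
Unset Printing Implicit Defensive.

(** * Calculus of C^k maps *)

(** Three features of the encoding shape the proof. A value [X x] is a row of components in the
    chart [chart_at x], which may jump from point to point; hence a field can be differentiated only
    after it is rewritten in a fixed pair of charts, and smoothness of a derived field needs its
    expression in every such pair. Next, [f] may fail to be injective and a vector field along [f]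
    need not come from a field on [M], so the hypotheses on [nablaM] cannot be applied to it
    directly. They are applied to constant coordinate fields instead, which turns them into
    pointwise identities between the derivative of the metric, or of [F], and the Christoffel
    symbols; the chain rule carries these along [f]. Finally, sections are smooth by definition, so
    every implication also has to supply the smoothness of h(X,Y), A_V Y or nabla_Y Z. For A_V Y, a
    tangential projection, this involves the inverse of a Gram matrix, whence a calculus of C^k maps
    that includes matrix inversion. *)

Lemma eq_derive (R : realType) (V W : normedModType R) (f g : V -> W) (p v : V) :
  f =1 g -> 'D_v f p = 'D_v g p.
Proof. by move=> /funext ->. Qed.

Section CkBasics.
Context (R : realType).
Implicit Types V W : normedModType R.

(** The first-order expansion of [f] at [p] is also one of [g]; uniqueness of the linear part
    identifies it with the differential of [g]. *)
Lemma near_eq_differentiable V W (f g : V -> W) (p : V) :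
  {near p, f =1 g} -> differentiable f p -> differentiable g p.
Proof.
move=> fg df; have [dfc dfE] := (diff_locallyP p f).1 df.
have gE : g \o shift p = cst (g p) + 'd f p +o_ 0 id.
  apply/eqaddoP => e e0.
  have /eqaddoP/(_ e e0) := dfE.
  have : \forall x \near (0 : V), f (shift p x) = g (shift p x).
    have : {near p, f =1 g} by [].
    by rewrite (near_shift 0); apply: filterS => x; rewrite /= subr0.
  apply: filterS2 => x /= fgx; rewrite -(nbhs_singleton fg).
  by move: fgx; rewrite /= !fctE /= => ->.
have dgE := diff_unique dfc gE.
by apply/diff_locallyP; rewrite dgE.
Qed.

Lemma near_eq_derive_near V W (f g : V -> W) (p v : V) :
  {near p, f =1 g} -> {near p, 'D_v f =1 'D_v g}.
Proof.
by move=> /near_join; apply: filterS => q; exact: near_eq_derive.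
Qed.

Lemma Ck_on_near V W k (U : set V) (f g : V -> W) :
  (forall p, U p -> {near p, f =1 g}) -> Ck_on k U f -> Ck_on k U g.
Proof.
elim: k f g => [|k IH] f g fg /= => [cf p Up|[df cf]].
  have := cf p Up; rewrite /prop_for /continuous_at -(nbhs_singleton (fg p Up)).
  by apply: cvg_trans; apply: near_eq_cvg; exact: fg.
split=> [p Up|v]; first exact: near_eq_differentiable (fg p Up) (df p Up).
by apply: IH (cf v) => p Up; apply: near_eq_derive_near (fg p Up).
Qed.

Lemma Ck_on_eq V W k (U : set V) (f g : V -> W) :
  open U -> {in U, f =1 g} -> Ck_on k U f -> Ck_on k U g.
Proof.
move=> oU fg; apply: Ck_on_near => p Up.
by have := open_nbhs_nbhs (conj oU Up); apply: filterS => q Uq; apply: fg; rewrite inE.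
Qed.

Lemma Ck_onS V W k (U U' : set V) (f : V -> W) :
  U' `<=` U -> Ck_on k U f -> Ck_on k U' f.
Proof.
elim: k f => [|k IH] f sU /= => [cf p /sU/cf//|[df cf]].
by split=> [p /sU/df//|v]; apply: IH (cf v).
Qed.

(** [Ck_on] imposes conditions only at the points of [U], so smoothness may be checked one point at
    a time, with auxiliary charts that depend on the point. *)
Lemma Ck_on_pointwise V W k (U : set V) (f : V -> W) :
  (forall p, U p -> Ck_on k [set p] f) -> Ck_on k U f.
Proof.
elim: k f => [|k IH] f /= H => [p /H/(_ p erefl)//|].
split=> [p /H[+ _]|v]; first exact.
by apply: IH => p /H[_]; exact.
Qed.

Lemma Ck_onW V W k (U : set V) (f : V -> W) : Ck_on k.+1 U f -> Ck_on k U f.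
Proof.
elim: k f => [|k IH] f [df cf].
  by move=> p /df; exact: differentiable_continuous.
by split=> // v; apply: IH.
Qed.

Lemma Ck_on_cst V W k (U : set V) (c : W) : Ck_on k U (fun=> c).
Proof.
elim: k c => [|k IH] c /=; first by move=> p _; exact: cvg_cst.
split=> [p _|v]; first exact: differentiable_cst.
apply: Ck_on_near (IH 0) => p _; apply: nearW => q.
by rewrite (derive_cst c q v).
Qed.

Lemma Ck_on_id V k (U : set V) : Ck_on k U (id : V -> V).
Proof.
case: k => [|k] /=; first by move=> p _; exact: cvg_id.
split=> [p _|v]; first exact: (@ex_diff _ _ _ _ _ _ _ (is_diff_id p)).
apply: Ck_on_near (Ck_on_cst k U v) => p _; apply: nearW => q.
by rewrite derive_id.
Qed.

Lemma Ck_onD V W k (U : set V) (f g : V -> W) :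
  open U -> Ck_on k U f -> Ck_on k U g -> Ck_on k U (fun p => f p + g p).
Proof.
move=> oU; elim: k f g => [|k IH] f g /= => [cf cg p Up|[df cf] [dg cg]].
  by apply: cvgD; [exact: cf|exact: cg].
split=> [p Up|v]; first by apply: differentiableD; [exact: df|exact: dg].
apply: Ck_on_eq (IH _ _ (cf v) (cg v)) => // p /[!inE] Up.
by rewrite deriveD //; apply: diff_derivable; [exact: df|exact: dg].
Qed.

Lemma Ck_onM V k (U : set V) (f g : V -> R) :
  open U -> Ck_on k U f -> Ck_on k U g -> Ck_on k U (fun p => f p * g p).
Proof.
move=> oU; elim: k f g => [|k IH] f g => [cf cg p Up|Cf Cg].
  by apply: cvgM; [exact: cf|exact: cg].
have [[df cf] [dg cg]] := (Cf, Cg).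
split=> [p Up|v]; first by apply: differentiableM; [exact: df|exact: dg].
have C := Ck_onD oU (IH _ _ (Ck_onW Cf) (cg v)) (IH _ _ (Ck_onW Cg) (cf v)).
apply: Ck_on_eq C => // p /[!inE] Up.
rewrite deriveM //; apply: diff_derivable; [exact: df|exact: dg].
Qed.

Lemma Ck_onV V k (U : set V) (f : V -> R) : open U ->
  (forall p, U p -> f p != 0) -> Ck_on k U f -> Ck_on k U (fun p => (f p)^-1).
Proof.
move=> oU f0; elim: k => [|k IH] => [cf p Up|Cf].
  by apply: cvgV; [exact: f0|exact: cf].
have [df cf] := Cf; have C := IH (Ck_onW Cf).
split=> [p Up|v]; first by apply: differentiableV; [exact: df|exact: f0].
apply: (Ck_on_eq (f := fun p => - 1 * ((f p)^-1 * (f p)^-1 * 'D_v f p))) => //.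
  move=> p /[!inE] Up; rewrite deriveV; [|exact: f0|exact/diff_derivable/df].
  by rewrite mulN1r -invfM -expr2 scaleNr.
apply: Ck_onM => //; first exact: Ck_on_cst.
by apply: Ck_onM (cf v) => //; apply: Ck_onM.
Qed.

Lemma Ck_on_sum V W k (U : set V) I (r : seq I) (P : pred I) (f : I -> V -> W) :
  open U -> (forall i, P i -> Ck_on k U (f i)) ->
  Ck_on k U (fun p => \sum_(i <- r | P i) f i p).
Proof.
move=> oU cf; elim: r => [|i r IH].
  apply: (Ck_on_eq (f := fun=> 0)) => //; last exact: Ck_on_cst.
  by move=> p _; rewrite big_nil.
apply: (Ck_on_eq (f := fun p =>
  (if P i then f i p else 0) + \sum_(i <- r | P i) f i p)) => //.
  by move=> p _; rewrite /= big_cons; case: (P i); rewrite ?add0r.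
apply: Ck_onD => //; case: (boolP (P i)) => Pi; [exact: cf|exact: Ck_on_cst].
Qed.

Lemma Ck_on_prod V k (U : set V) I (r : seq I) (P : pred I) (f : I -> V -> R) :
  open U -> (forall i, P i -> Ck_on k U (f i)) ->
  Ck_on k U (fun p => \prod_(i <- r | P i) f i p).
Proof.
move=> oU cf; elim: r => [|i r IH].
  apply: (Ck_on_eq (f := (fun=> 1) : V -> R)) => //; last exact: Ck_on_cst.
  by move=> p _; rewrite big_nil.
apply: (Ck_on_eq (f := fun p =>
  (if P i then f i p else 1 : R) * \prod_(i <- r | P i) f i p)) => //.
  by move=> p _; rewrite /= big_cons; case: (P i); rewrite ?mul1r.
apply: Ck_onM => //; case: (boolP (P i)) => Pi; [exact: cf|exact: Ck_on_cst].
Qed.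

End CkBasics.

(** * Matrix-valued maps: differentiation, smoothness, composition *)

Section Matrices.
Context (R : realType).
Implicit Types V W : normedModType R.

Lemma differentiable_mxP V m n (A : V -> 'M[R]_(m, n)) (p : V) :
  differentiable A p <-> forall i j, differentiable (fun q => A q i j) p.
Proof.
split=> [dA i j|dA].
  exact: (differentiable_comp dA (differentiable_coord (A p) i j)).
have -> : A = \sum_(i < m) \sum_(j < n) (fun q => A q i j *: delta_mx i j).
  apply/funext => q; rewrite fct_sumE [LHS]matrix_sum_delta.
  by apply: eq_bigr => i _; rewrite fct_sumE.
by do 2!apply: differentiable_sum => ?; exact: differentiableZl.
Qed.

Lemma derive_coord V m n (A : V -> 'M[R]_(m, n)) (p v : V) i j :
  differentiable A p -> ('D_v A p) i j = 'D_v (fun q => A q i j) p.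
Proof. by move=> dA; rewrite derive_mx ?mxE //; exact: diff_derivable. Qed.

Lemma derive_mul V (f g : V -> R) (p v : V) :
  differentiable f p -> differentiable g p ->
  'D_v (fun q => f q * g q) p = 'D_v f p * g p + f p * 'D_v g p.
Proof.
move=> df dg; rewrite deriveM; try exact: diff_derivable.
by rewrite addrC; congr (_ + _); rewrite /GRing.scale /= mulrC.
Qed.

Lemma derive_suml V W I (r : seq I) (f : I -> V -> W) (p v : V) :
  (forall i, differentiable (f i) p) ->
  differentiable (fun q => \sum_(i <- r) f i q) p /\
  'D_v (fun q => \sum_(i <- r) f i q) p = \sum_(i <- r) 'D_v (f i) p.
Proof.
move=> df; elim: r => [|i r [dr Dr]].
  rewrite big_nil (_ : (fun _ => _) = fun=> 0).
    by split; [exact: differentiable_cst|exact: derive_cst].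
  by apply/funext => q; rewrite big_nil.
rewrite (_ : (fun _ => _) = f i + (fun q => \sum_(i <- r) f i q)).
  split; first exact: differentiableD.
  by rewrite deriveD ?Dr ?big_cons //; exact: diff_derivable.
by apply/funext => q; rewrite big_cons.
Qed.

Lemma differentiable_mulmx V l m n (A : V -> 'M[R]_(l, m))
    (B : V -> 'M[R]_(m, n)) p :
  differentiable A p -> differentiable B p ->
  differentiable (fun q => A q *m B q) p.
Proof.
move=> /differentiable_mxP dA /differentiable_mxP dB; apply/differentiable_mxP.
move=> i j; under eq_fun do rewrite mxE.
have [] // := @derive_suml V R _ (index_enum 'I_m)
  (fun k q => A q i k * B q k j) p 0 => k.
exact: differentiableM.
Qed.

Lemma derive_mulmx V l m n (A : V -> 'M[R]_(l, m)) (B : V -> 'M[R]_(m, n)) p v :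
  differentiable A p -> differentiable B p ->
  'D_v (fun q => A q *m B q) p = 'D_v A p *m B p + A p *m 'D_v B p.
Proof.
move=> dA dB; have dAB := differentiable_mulmx dA dB.
apply/matrixP => i j; rewrite derive_coord //.
under eq_fun do rewrite mxE.
have /differentiable_mxP dA' := dA; have /differentiable_mxP dB' := dB.
have [|_ ->] := @derive_suml V R _ (index_enum 'I_m)
  (fun k q => A q i k * B q k j) p v; first by move=> k; exact: differentiableM.
rewrite !mxE -big_split; apply: eq_bigr => k _ /=.
by rewrite derive_mul // !derive_coord.
Qed.

Lemma differentiable_trmx V m n (A : V -> 'M[R]_(m, n)) p :
  differentiable A p -> differentiable (fun q => (A q)^T) p.
Proof.
move=> /differentiable_mxP dA; apply/differentiable_mxP => i j.
by under eq_fun do rewrite mxE.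
Qed.

Lemma derive_trmx V m n (A : V -> 'M[R]_(m, n)) p v : differentiable A p ->
  'D_v (fun q => (A q)^T) p = ('D_v A p)^T.
Proof.
move=> dA; apply/matrixP => i j.
rewrite derive_coord ?mxE ?derive_coord //; last exact: differentiable_trmx.
by under eq_fun do rewrite mxE.
Qed.

Lemma derive_comp (U : normedModType R) V W (f : U -> V) (h : V -> W) (p v : U) :
  differentiable f p -> differentiable h (f p) ->
  'D_v (h \o f) p = 'D_('D_v f p) h (f p).
Proof.
move=> df dh; have dhf := differentiable_comp df dh.
by rewrite (deriveE v dhf) (deriveE _ dh) (deriveE v df) (diff_comp df dh).
Qed.

Lemma derive_coord_sum m W (h : 'rV[R]_m -> W) p u : differentiable h p ->
  'D_u h p = \sum_(a < m) u 0 a *: 'D_(delta_mx 0 a) h p.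
Proof.
move=> dh; rewrite deriveE // {1}[u]row_sum_delta linear_sum.
by apply: eq_bigr => a _; rewrite linearZ deriveE.
Qed.

Lemma Ck_onZl V W k (U : set V) (c : V -> R) (w : W) : open U ->
  Ck_on k U c -> Ck_on k U (fun p => c p *: w).
Proof.
move=> oU; elim: k c => [|k IH] c /= => [cc p Up|[dc cc]].
  by apply: cvgZr_tmp; exact: cc.
split=> [p Up|v]; first exact/differentiableZl/dc.
apply: Ck_on_eq (IH _ (cc v)) => // p /[!inE] Up.
have dcp := dc p Up; have dcw := differentiableZl w dcp.
by rewrite (deriveE v dcp) (deriveE v dcw) diffZl.
Qed.

Lemma Ck_on_mx V m n k (U : set V) (A : V -> 'M[R]_(m, n)) : open U ->
  (forall i j, Ck_on k U (fun q => A q i j)) -> Ck_on k U A.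
Proof.
move=> oU CA.
apply: (Ck_on_eq (f := fun q => \sum_i \sum_j A q i j *: delta_mx i j)) => //.
  by move=> q _; rewrite [RHS]matrix_sum_delta.
by do 2!(apply: Ck_on_sum => // ? _); exact: Ck_onZl.
Qed.

Lemma Ck_on_coord V m n k (U : set V) (A : V -> 'M[R]_(m, n)) i j : open U ->
  Ck_on k U A -> Ck_on k U (fun q => A q i j).
Proof.
move=> oU; elim: k A => [|k IH] A /= => [cA p Up|[dA cA]].
  exact: (@continuous_comp _ _ _ A (fun B => B i j) p (cA p Up)
    (@coord_continuous R m n i j (A p))).
split=> [p Up|v]; first by have /differentiable_mxP := dA p Up; apply.
by apply: Ck_on_eq (IH _ (cA v)) => // p /[!inE] Up; rewrite derive_coord //; exact: dA.
Qed.

Lemma Ck_on_mulmx V l m n k (U : set V) (A : V -> 'M[R]_(l, m))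
    (B : V -> 'M[R]_(m, n)) : open U ->
  Ck_on k U A -> Ck_on k U B -> Ck_on k U (fun q => A q *m B q).
Proof.
move=> oU cA cB; apply: Ck_on_mx => // i j.
apply: (Ck_on_eq (f := fun q => \sum_a A q i a * B q a j)) => //.
  by move=> q _; rewrite mxE.
by apply: Ck_on_sum => // a _; apply: Ck_onM => //; exact: Ck_on_coord.
Qed.

Lemma Ck_on_trmx V m n k (U : set V) (A : V -> 'M[R]_(m, n)) : open U ->
  Ck_on k U A -> Ck_on k U (fun q => (A q)^T).
Proof.
move=> oU cA; apply: Ck_on_mx => // i j.
apply: (Ck_on_eq (f := fun q => A q j i)) => //; last exact: Ck_on_coord.
by move=> q _; rewrite mxE.
Qed.

Lemma Ck_onZ V m n k (U : set V) (c : V -> R) (A : V -> 'M[R]_(m, n)) :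
  open U -> Ck_on k U c -> Ck_on k U A -> Ck_on k U (fun q => c q *: A q).
Proof.
move=> oU cc cA; apply: Ck_on_mx => // i j.
apply: (Ck_on_eq (f := fun q => c q * A q i j)) => //.
  by move=> q _; rewrite mxE.
by apply: Ck_onM => //; exact: Ck_on_coord.
Qed.

Lemma Ck_onN V m n k (U : set V) (A : V -> 'M[R]_(m, n)) :
  open U -> Ck_on k U A -> Ck_on k U (fun q => - A q).
Proof.
move=> oU cA; apply: (Ck_on_eq (f := fun q => (-1) *: A q)) => //.
  by move=> q _; rewrite scaleN1r.
by apply: Ck_onZ => //; exact: Ck_on_cst.
Qed.

Lemma Ck_on_det V n k (U : set V) (A : V -> 'M[R]_n) :
  open U -> Ck_on k U A -> Ck_on k U (fun q => \det (A q)).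
Proof.
move=> oU cA; apply: Ck_on_sum => // s _.
apply: Ck_onM => //; first exact: Ck_on_cst.
by apply: Ck_on_prod => // i _; exact: Ck_on_coord.
Qed.

(** By Cramer's formula the entries of the inverse are cofactors divided by the determinant. *)
Lemma Ck_on_invmx V n k (U : set V) (A : V -> 'M[R]_n) : open U ->
  (forall p, U p -> A p \in unitmx) -> Ck_on k U A ->
  Ck_on k U (fun q => invmx (A q)).
Proof.
move=> oU uA cA.
apply: (Ck_on_eq (f := fun q => (\det (A q))^-1 *: \adj (A q))) => //.
  by move=> q /[!inE] /uA; rewrite /invmx => ->.
apply: Ck_onZ => //.
  apply: Ck_onV => //; last exact: Ck_on_det.
  by move=> p /uA; rewrite unitmxE unitfE.
apply: Ck_on_mx => // i j.
apply: (Ck_on_eq (f := fun q => cofactor (A q) j i)) => //.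
  by move=> q _; rewrite mxE.
apply: Ck_onM => //; first exact: Ck_on_cst.
apply: Ck_on_det => //; apply: Ck_on_mx => // a b.
apply: (Ck_on_eq (f := fun q => A q (lift j a) (lift i b))) => //.
  by move=> q _; rewrite !mxE.
exact: Ck_on_coord.
Qed.

(** The chain rule writes the derivative as a sum of products of components of ['D_v f] with partial
    derivatives of [h] composed with [f]. The induction therefore runs over all [h] for a fixed [f],
    and scalar values of [h] allow the use of [Ck_onM]. *)
Lemma Ck_on_comp_scalar V m k (U : set V) (U' : set 'rV[R]_m)
    (f : V -> 'rV[R]_m) (h : 'rV[R]_m -> R) : open U ->
  (forall p, U p -> U' (f p)) -> Ck_on k U f -> Ck_on k U' h ->
  Ck_on k U (h \o f).
Proof.
move=> oU UU'; elim: k h => [|k IH] h => [cf ch p Up|Cf [dh ch]].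
  by apply: continuous_comp; [exact: cf|exact/ch/UU'].
have [df cf] := Cf.
split=> [p Up|v]; first by apply: differentiable_comp; [exact: df|exact/dh/UU'].
apply: (Ck_on_eq (f := fun p =>
  \sum_(a < m) 'D_v f p 0 a * ('D_(delta_mx 0 a) h \o f) p)) => //.
  move=> p /[!inE] Up; have dhp := dh _ (UU' p Up).
  by rewrite (derive_comp v (df p Up) dhp) (derive_coord_sum _ dhp).
apply: Ck_on_sum => // a _; apply: Ck_onM => //.
  exact: (Ck_on_coord 0 a oU (cf v)).
by apply: IH (ch _); exact: Ck_onW.
Qed.

Lemma Ck_on_comp V m a b k (U : set V) (U' : set 'rV[R]_m)
    (f : V -> 'rV[R]_m) (h : 'rV[R]_m -> 'M[R]_(a, b)) : open U -> open U' ->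
  (forall p, U p -> U' (f p)) -> Ck_on k U f -> Ck_on k U' h ->
  Ck_on k U (h \o f).
Proof.
move=> oU oU' UU' cf ch; apply: Ck_on_mx => // i j.
exact: (Ck_on_comp_scalar oU UU' cf (Ck_on_coord i j oU' ch)).
Qed.

Lemma jacobianE m n (f : 'rV[R]_m -> 'rV[R]_n) p i j : differentiable f p ->
  'J f p i j = 'D_(delta_mx 0 i) f p 0 j.
Proof. by move=> df; rewrite deriveEjacobian // -rowE [RHS]mxE. Qed.

Lemma Ck_on_jacobian m n k (U : set 'rV[R]_m) (f : 'rV[R]_m -> 'rV[R]_n) :
  open U -> Ck_on k.+1 U f -> Ck_on k U (fun q => 'J f q).
Proof.
move=> oU [df cf]; apply: Ck_on_mx => // i j.
apply: (Ck_on_eq (f := fun q => 'D_(delta_mx 0 i) f q 0 j)) => //.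
  by move=> q /[!inE] /df dq; rewrite jacobianE.
exact: (Ck_on_coord 0 j oU (cf (delta_mx 0 i))).
Qed.

End Matrices.

(** * Symmetry of second derivatives *)

Section Clairaut.
Context (R : realType) (V : normedModType R).

Lemma is_diff_ext (U W : normedModType R) (f f' df df' : U -> W) (x : U) :
  is_diff x f df -> f = f' -> df = df' -> is_diff x f' df'.
Proof. by move=> h <- <-. Qed.

Lemma derive_line (W : normedModType R) (f : V -> W) (p u : V) (s : R) :
  differentiable f (p + s *: u) ->
  is_derive s (1 : R) (fun s : R => f (p + s *: u)) ('D_u f (p + s *: u)).
Proof.
move=> df.
have dl : is_diff s (fun s : R => p + s *: u) (fun h : R => h *: u).
  apply: (is_diff_ext (is_diffD (is_diff_cst p s) (is_diff_scalel s u))) => //.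
  by rewrite add0r.
have dc : differentiable (f \o (fun s : R => p + s *: u)) s.
  by apply: differentiable_comp.
apply: DeriveDef; first exact: diff_derivable.
rewrite deriveE // diff_comp //= (@diff_val _ _ _ _ _ _ _ dl).
by rewrite scale1r deriveE.
Qed.

Lemma mean_value_line (f : V -> R) (p u : V) (t : R) : 0 < t ->
  (forall s, 0 <= s <= t -> differentiable f (p + s *: u)) ->
  exists2 c, 0 <= c <= t & f (p + t *: u) - f p = t * 'D_u f (p + c *: u).
Proof.
move=> t0 df.
have [||c] := @MVT R (fun s : R => f (p + s *: u))
  (fun s : R => 'D_u f (p + s *: u)) 0 t t0.
- move=> s /[!in_itv]/= /andP[s0 st]; apply: derive_line.
  by apply: df; rewrite !ltW.
- apply: derivable_within_continuous => s /[!in_itv]/= st.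
  by have [] := derive_line (df s st).
rewrite in_itv /= => /andP[c0 ct]; rewrite scale0r addr0 subr0 => E.
by exists c; rewrite ?ltW // E mulrC.
Qed.

(** Two uses of the mean value theorem: for the increment of [f] by [t *: v], along [u], and then
    for ['D_u f], along [v]. *)
Lemma second_difference (U : set V) (f : V -> R) (p u v : V) (t : R) : 0 < t ->
  Ck_on 2 U f ->
  (forall a b, 0 <= a <= t -> 0 <= b <= t -> U (p + a *: u + b *: v)) ->
  exists a b, [/\ 0 <= a <= t, 0 <= b <= t &
    f (p + t *: u + t *: v) - f (p + t *: u) - (f (p + t *: v) - f p)
    = t * (t * 'D_v ('D_u f) (p + a *: u + b *: v))].
Proof.
move=> t0 [df cf] Up.
have t00 : 0 <= t <= t by rewrite lexx ltW.
have z0 : 0 <= (0 : R) <= t by rewrite lexx ltW.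
have df1 s : 0 <= s <= t -> differentiable f (p + s *: u).
  by move=> st; have := Up s 0 st z0; rewrite scale0r addr0 => /df.
have df2 s : 0 <= s <= t -> differentiable f (p + s *: u + t *: v).
  by move=> st; exact/df/Up.
have ds s : 0 <= s <= t ->
    is_diff (p + s *: u) (fun q => q + t *: v) id.
  move=> st; apply: (is_diff_ext (is_diffD (is_diff_id (p + s *: u))
    (is_diff_cst (t *: v) (p + s *: u)))) => //.
  by rewrite addr0.
have dc s : 0 <= s <= t ->
    differentiable (f \o (fun q => q + t *: v)) (p + s *: u).
  move=> st; have := ds s st => ?.
  by apply: differentiable_comp => //; exact: df2.
have [|a at_ E] := @mean_value_line (fun q => f (q + t *: v) - f q) p u t t0.
  by move=> s st; apply: differentiableB; [exact: dc|exact: df1].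
have [|b bt E'] := @mean_value_line ('D_u f) (p + a *: u) v t t0.
  by move=> s st; have [+ _] := cf u; apply; exact: Up.
exists a, b; split=> //; move: E => /= E.
rewrite -E'; transitivity (t * 'D_u (fun q => f (q + t *: v) - f q) (p + a *: u)).
  exact: E.
congr (_ * _); rewrite deriveB; try by apply: diff_derivable; auto.
congr (_ - _); rewrite !deriveE; [|exact: df2|exact: dc].
rewrite (@diff_comp R V V R); [|by have [] := ds a at_|exact: df2].
by rewrite /= (@diff_val _ _ _ _ _ _ _ (ds a at_)).
Qed.

Lemma dist_le_half (a b x y e : R) : x = y ->
  `|a - x| < e / 2 -> `|b - y| < e / 2 -> `|a - b| <= e.
Proof.
move=> -> ha hb; rewrite (le_trans (ler_distD y a b)) // [e]splitr lerD ?ltW //.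
by rewrite distrC.
Qed.

(** The second difference is symmetric in [u] and [v], so the two mixed derivatives take a common
    value at two points of any small parallelogram at [p]; their continuity at [p] does the rest. *)
Lemma clairaut_scalar (U : set V) (f : V -> R) (p u v : V) : open U ->
  Ck_on 2 U f -> U p -> 'D_v ('D_u f) p = 'D_u ('D_v f) p.
Proof.
move=> oU Cf Up; apply/eqP; rewrite -subr_eq0 -normr_le0.
apply/ler_addgt0Pl => e e0; rewrite addr0.
have [_ cf] := Cf.
have c1 := (cf u).2 v p Up; have c2 := (cf v).2 u p Up.
have e2 : 0 < e / 2 by rewrite divr_gt0.
have : \forall q \near p, U q /\
    (`|'D_v ('D_u f) p - 'D_v ('D_u f) q| < e / 2 /\
     `|'D_u ('D_v f) p - 'D_u ('D_v f) q| < e / 2).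
  apply: filterI; first exact: open_nbhs_nbhs.
  apply: filterI.
    by have /cvgrPdist_lt/(_ _ e2) := c1.
  by have /cvgrPdist_lt/(_ _ e2) := c2.
move=> /nbhs_ballP[r /= r0 rU].
(* Small enough to keep the parallelogram in the ball of radius [r]; the summand 1 keeps the
   denominator positive when [u] and [v] vanish. *)
pose t := r / (2 * (1 + `|u| + `|v|)).
have K0 : 0 < 1 + `|u| + `|v| by rewrite -addrA ltr_pwDl // addr_ge0.
have t0 : 0 < t by rewrite divr_gt0 // mulr_gt0.
have tr : t * `|u| + t * `|v| < r.
  rewrite -mulrDr /t mulrAC ltr_pdivrMr ?mulr_gt0 //.
  rewrite ltr_pM2l // mulr_natl mulr2n.
  apply: (@lt_le_trans _ _ (1 + `|u| + `|v|)); first by rewrite -addrA ltrDr.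
  by rewrite lerDl ltW.
have near_p a b : 0 <= a <= t -> 0 <= b <= t -> ball p r (p + a *: u + b *: v).
  move=> /andP[a0 at_] /andP[b0 bt]; rewrite -ball_normE /= -addrA opprD addNKr.
  rewrite normrN (le_lt_trans (ler_normD _ _)) // !normrZ !ger0_norm //.
  by apply: le_lt_trans tr; rewrite lerD // ler_wpM2r.
have inU a b ha hb := (rU _ (near_p a b ha hb)).1.
have [a [b [ha hb E]]] := second_difference t0 Cf inU.
have inU' b' a' (hb' : 0 <= b' <= t) (ha' : 0 <= a' <= t) :
  U (p + b' *: v + a' *: u) by rewrite addrAC; exact: inU.
have [b' [a' [hb' ha' E']]] := second_difference t0 Cf inU'.
have EE : 'D_v ('D_u f) (p + a *: u + b *: v) = 'D_u ('D_v f) (p + a' *: u + b' *: v).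
  have tn0 : t != 0 by rewrite gt_eqF.
  rewrite (addrAC p (t *: v)) (addrAC p (b' *: v)) in E'.
  move: E E'; set X : R := 'D_v _ _; set Y : R := 'D_u _ _ => E E'.
  have /(mulfI tn0)/(mulfI tn0) // : t * (t * X) = t * (t * Y).
  by apply: (etrans (esym E) (etrans _ E')); ring.
have [_ [h1 _]] := rU _ (near_p a b ha hb).
have [_ [_ h2]] := rU _ (near_p a' b' ha' hb').
exact: (dist_le_half EE h1 h2).
Qed.

End Clairaut.

(** * Bump functions *)

Section Flat.
Context (R : realType).

(* The derivative of P(1/t) exp(-1/t) has the same form, so that the smoothness of
   flat 1 is an induction over all polynomials P at once. *)
Definition flat (P : {poly R}) (t : R) : R :=
  if 0 < t then P.[t^-1] * expR (- t^-1) else 0.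

Lemma flat_le0 P t : t <= 0 -> flat P t = 0.
Proof. by rewrite /flat leNgt => /negbTE ->. Qed.

(** The exponential dominates the term of degree n+1 of its series. The degree in excess of [n]
    leaves the factor 1/s, which becomes t when s = 1/t. *)
Lemma expRN_le_pow (s : R) n : 0 < s -> s ^+ n * expR (- s) <= n.+1`!%:R / s.
Proof.
move=> s0; have f0 : 0 < n.+1`!%:R :> R by rewrite ltr0n fact_gt0.
have := expR_ge1Dxn n (ltW s0).
rewrite expRN ler_pdivrMr ?expR_gt0 // mulrAC ler_pdivlMr // -exprSr => h.
rewrite mulrC -ler_pdivrMr //; apply: le_trans h.
by rewrite lerDr.
Qed.

(** This linear bound is all that is needed at the origin: taken for ['X * P] it bounds the
    difference quotient of [flat P] at 0. *)
Lemma flat_bound P : exists C, forall t, `|flat P t| <= C * `|t|.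
Proof.
exists (\sum_(i < size P) `|P`_i| * i.+1`!%:R) => t; rewrite /flat.
case: ifP => t0; last by rewrite normr0 mulr_ge0 // sumr_ge0.
have s0 : 0 < t^-1 by rewrite invr_gt0.
rewrite horner_coef mulr_suml mulr_suml (le_trans (ler_norm_sum _ _ _)) //.
apply: ler_sum => i _; rewrite -!mulrA normrM ler_wpM2l //.
rewrite ger0_norm ?mulr_ge0 ?expR_ge0 ?exprn_ge0 ?(ltW s0) //.
by have := expRN_le_pow i s0; rewrite invrK (gtr0_norm t0).
Qed.

(** With s = 1/t one has d/dt = - s^2 d/ds, and the s-derivative of P(s) exp(-s) is (P' - P)(s)
    exp(-s); hence the polynomial X^2 (P - P'). *)
Lemma flat_derive P (t : R) :
  is_derive t 1 (flat P) (flat ('X^2 * (P - P^`())) t).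
Proof.
have [t0|t0|->] := ltgtP t 0.
- rewrite (flat_le0 _ (ltW t0)).
  apply: (near_eq_is_derive _ (is_derive_cst (0 : R) t (1 : R))).
  by apply: filterS (lt_nbhsl t0) => x x0; rewrite flat_le0 // ltW.
- have tn0 : t != 0 by rewrite gt_eqF.
  rewrite {2}/flat t0.
  have di : is_derive t 1 (fun x : R => x^-1) (- t ^- 2).
    have := is_deriveV tn0 (is_derive_id t (1 : R)).
    by rewrite /GRing.scale /= mulr1.
  have dP := is_derive1_comp (is_derive_poly P t^-1) di.
  have dE := @is_derive1_comp R expR (- GRing.inv) t _ _
    (is_derive_expR (- t^-1)) (is_deriveN di).
  have near_flat : {near t, (horner P \o GRing.inv) * (expR \o (- GRing.inv)) =1
      flat P}.
    by apply: filterS (lt_nbhsr t0) => x x0; rewrite /flat x0.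
  apply: (near_eq_is_derive near_flat).
  apply: (is_derive_eq (is_deriveM dP dE)).
  rewrite /= !hornerE /GRing.scale /= -exprVn.
  by ring.
- have [C hC] := flat_bound ('X * P).
  rewrite flat_le0 //.
  have cv : h^-1 *: (flat P (h *: (1 : R) + 0) - flat P 0) @[h --> (0 : R)^'] --> (0 : R).
    apply/cvgrPdist_lt => e e0; near=> h.
    have hn0 : h != 0 by near: h; exact: nbhs_dnbhs_neq.
    have -> : h^-1 *: (flat P (h *: (1 : R) + 0) - flat P 0) = flat ('X * P) h.
      rewrite addr0 /GRing.scale /= mulr1 (flat_le0 P (lexx 0)) subr0 /flat.
      by case: ifP => _; rewrite ?mulr0 // hornerM hornerX mulrA.
    rewrite sub0r normrN (le_lt_trans (hC h)) //.
    (* Nothing is known about the sign of [C], whereas [|C| + 1] is positive and can be divided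
       by. *)
    rewrite (@le_lt_trans _ _ ((`|C| + 1) * `|h|)) //.
      by rewrite ler_wpM2r // (le_trans (ler_norm C)) // lerDl.
    rewrite mulrC -ltr_pdivlMr ?ltr_wpDl //.
    near: h; apply: dnbhs0_lt; rewrite divr_gt0 // ltr_wpDl //.
  by apply: DeriveDef; [apply/cvg_ex; exists 0|apply/cvg_lim].
Unshelve. all: by end_near. Qed.

Lemma Ck_on_flat (V : normedModType R) k (U : set V) (P : {poly R})
    (f : V -> R) : open U -> Ck_on k U f -> Ck_on k U (fun p => flat P (f p)).
Proof.
move=> oU; elim: k P f => [|k IH] P f Cf.
  move=> p Up; apply: (@continuous_comp _ _ _ f (flat P) p (Cf p Up)).
  apply/differentiable_continuous/derivable1_diffP.
  by have [] := flat_derive P (f p).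
have [df cf] := Cf.
have dP s : differentiable (flat P) s.
  by apply/derivable1_diffP; have [] := flat_derive P s.
split=> [p Up|v].
  exact: (differentiable_comp (df p Up) (dP (f p))).
apply: (Ck_on_eq (f := fun p =>
  'D_v f p * flat ('X^2 * (P - P^`())) (f p))) => //.
  move=> p /[!inE] Up.
  apply: etrans _ (esym (derive_comp v (df p Up) (dP (f p)))).
  have [_ DP] := flat_derive P (f p).
  have dPd := deriveE ('D_v f p) (dP (f p)).
  rewrite dPd -[X in 'd _ _ X]mulr1 [RHS]linearZ /=; congr (_ * _).
  by rewrite -DP deriveE.
by apply: Ck_onM (cf v) _ => //; apply: IH; exact: Ck_onW.
Qed.

(** The norm of row vectors is the maximum norm, which is not smooth; the squared Euclidean distance
    [d] is a polynomial and dominates the square of each coordinate difference, so [r ^+ 2 - d q] is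
    not positive outside the ball of radius [r]. *)
Lemma bump_function n (p : 'rV[R]_n) (r : R) : 0 < r ->
  exists b : 'rV[R]_n -> R, [/\ smooth_on setT b, b p = 1 &
    forall q, b q != 0 -> `|p - q| <= r].
Proof.
move=> r0; pose d (q : 'rV[R]_n) : R := \sum_(k < n) (q 0 k - p 0 k) ^+ 2.
have f0 : flat 1 (r ^+ 2) != 0.
  by rewrite /flat exprn_gt0 // hornerC mul1r gt_eqF // expR_gt0.
exists (fun q => flat 1 (r ^+ 2 - d q) / flat 1 (r ^+ 2)); split.
- move=> k; apply: Ck_onM; [exact: openT| |exact: Ck_on_cst].
  apply: Ck_on_flat; first exact: openT.
  apply: Ck_onD; [exact: openT|exact: Ck_on_cst|].
  apply: (Ck_on_eq (f := fun q => (-1) * d q)); first exact: openT.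
    by move=> q _; rewrite mulN1r.
  apply: Ck_onM; [exact: openT|exact: Ck_on_cst|].
  apply: Ck_on_sum => [|i _]; first exact: openT.
  have Ci : Ck_on k setT (fun q : 'rV[R]_n => q 0 i - p 0 i).
    apply: Ck_onD; [exact: openT| |exact: Ck_on_cst].
    exact: (Ck_on_coord 0 i openT (Ck_on_id k setT)).
  exact: (Ck_onM openT Ci Ci).
- rewrite (_ : d p = 0) ?subr0 ?divff //.
  by rewrite /d big1 // => i _; rewrite subrr expr0n.
- move=> q; apply: contraR; rewrite -ltNge => h.
  rewrite flat_le0 ?mul0r // subr_le0.
  move: h; rewrite {1}/Num.Def.normr /= mx_normrE => /bigmax_gtP[|[[i k] _]].
    by rewrite ltNge ltW.
  rewrite /= !mxE (ord1 i) => rk.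
  rewrite /d (bigD1 k) //= -[leLHS]addr0 lerD ?sumr_ge0 //; last first.
    by move=> l _; rewrite sqr_ge0.
  rewrite -(real_normK (num_real (q 0 k - p 0 k))) distrC.
  by rewrite lerXn2r ?nnegrE ?(ltW r0) ?(ltW rk).
Qed.

End Flat.

(** * Jacobian matrices and their derivatives *)

Section Jacobian.
Context (R : realType).

Lemma jacobian_comp l m n (f : 'rV[R]_l -> 'rV[R]_m) (h : 'rV[R]_m -> 'rV[R]_n) p :
  differentiable f p -> differentiable h (f p) ->
  'J (h \o f) p = 'J f p *m 'J h (f p).
Proof.
move=> df dh; apply/row_matrixP => i; rewrite !rowE mulmxA.
rewrite -(deriveEjacobian _ df) -(deriveEjacobian _ dh) -deriveEjacobian.
  exact: derive_comp.
exact: differentiable_comp.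
Qed.

Lemma near_eq_jacobian m n (f h : 'rV[R]_m -> 'rV[R]_n) p :
  {near p, f =1 h} -> differentiable f p -> 'J f p = 'J h p.
Proof.
move=> fh df; have dh := near_eq_differentiable fh df.
apply/matrixP => i j.
apply: etrans (jacobianE i j df) _.
apply: etrans _ (esym (jacobianE i j dh)).
by rewrite (near_eq_derive (delta_mx 0 i) fh).
Qed.

Lemma jacobian_id n (p : 'rV[R]_n) : 'J id p = 1%:M.
Proof.
have di : differentiable id p := @ex_diff _ _ _ _ _ _ _ (is_diff_id p).
apply/row_matrixP => i; rewrite (rowE i ('J id p)) (rowE i 1%:M) mulmx1.
by rewrite -(deriveEjacobian _ di) derive_id.
Qed.

Lemma derive_lin_mulmx (V : normedModType R) l m n (u : 'M[R]_(l, m))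
    (A : V -> 'M[R]_(m, n)) p v : differentiable A p ->
  'D_v (fun q => u *m A q) p = u *m 'D_v A p.
Proof.
move=> dA; rewrite (derive_mulmx _ (differentiable_cst u p) dA).
by rewrite (derive_cst u p v) mul0mx add0r.
Qed.

Lemma clairaut m n (U : set 'rV[R]_m) (f : 'rV[R]_m -> 'rV[R]_n) p u v :
  open U -> Ck_on 2 U f -> U p -> 'D_u ('D_v f) p = 'D_v ('D_u f) p.
Proof.
move=> oU Cf Up; apply/rowP => j.
have Cfj := Ck_on_coord 0 j oU Cf; have [df cf] := Cf.
have E w : {near p, (fun q => 'D_w f q 0 j) =1 'D_w (fun q => f q 0 j)}.
  apply: filterS (open_nbhs_nbhs (conj oU Up)) => q Uq.
  by rewrite derive_coord //; exact: df.
have dd w : differentiable ('D_w f) p by have [+ _] := cf w; apply.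
apply: etrans (derive_coord u 0 j (dd v)) _.
apply: etrans _ (esym (derive_coord v 0 j (dd u))).
apply: etrans (near_eq_derive u (E v)) _.
apply: etrans _ (esym (near_eq_derive v (E u))).
exact: (clairaut_scalar v u oU Cfj Up).
Qed.

Lemma derive_jacobian m n (U : set 'rV[R]_m) (f : 'rV[R]_m -> 'rV[R]_n) p u v :
  open U -> Ck_on 2 U f -> U p ->
  v *m 'D_u (fun q => 'J f q) p = 'D_u ('D_v f) p.
Proof.
move=> oU Cf Up; have [dJ _] := Ck_on_jacobian oU Cf; have [df _] := Cf.
rewrite -(derive_lin_mulmx v u (dJ p Up)); apply: near_eq_derive.
apply: filterS (open_nbhs_nbhs (conj oU Up)) => q Uq.
by rewrite deriveEjacobian //; exact: df.
Qed.

(** Symmetry of the Hessian, in the form in which it arises when a field pushed forward by the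
    Jacobian is differentiated. *)
Lemma derive_jacobian_sym m n (U : set 'rV[R]_m) (f : 'rV[R]_m -> 'rV[R]_n) p u v :
  open U -> Ck_on 2 U f -> U p ->
  v *m 'D_u (fun q => 'J f q) p = u *m 'D_v (fun q => 'J f q) p.
Proof.
move=> oU Cf Up; rewrite (derive_jacobian u v oU Cf Up).
by rewrite (derive_jacobian v u oU Cf Up) (clairaut u v oU Cf Up).
Qed.

End Jacobian.

(** * Charts and covariant derivatives along a map *)

Section Charts.
Context (R : realType) (n : nat) (M : manifold R n).
Implicit Types (i j k : chart_index M) (x : M) (p : 'rV[R]_n) (U : set M).

Lemma param_chart i x : dom i x -> param i (chart i x) = x.
Proof. by move=> ix; apply: chartK; rewrite inE. Qed.

Lemma chart_imageE i U p :
  (chart i @` (dom i `&` U)) p <-> chart_image i p /\ U (param i p).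
Proof.
split=> [[x [ix Ux] <-]|[[x ix <-]]].
  by rewrite param_chart //; split=> //; exists x.
by rewrite param_chart // => Ux; exists x.
Qed.

Lemma chart_param i p : chart_image i p -> chart i (param i p) = p.
Proof. by move=> [x ix <-]; rewrite param_chart. Qed.

Lemma dom_param i p : chart_image i p -> dom i (param i p).
Proof. by move=> [x ix <-]; rewrite param_chart. Qed.

Lemma chart_image_chart i x : dom i x -> chart_image i (chart i x).
Proof. by move=> ix; exists x. Qed.

Lemma open_chart_image i U : open U -> open (chart i @` (dom i `&` U)).
Proof.
move=> oU; rewrite openE => p /chart_imageE[pi Up].
apply: filterS (filterI (open_nbhs_nbhs (conj (@chart_open _ _ _ i) pi))
  (@param_continuous _ _ _ i p pi _ (open_nbhs_nbhs (conj oU Up)))).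
by move=> q [qi Uq]; apply/chart_imageE.
Qed.

Lemma near_param i x U : dom i x -> nbhs x U ->
  \forall q \near chart i x, chart_image i q /\ U (param i q).
Proof.
move=> ix Ux; have pi := chart_image_chart ix.
apply: filterI (open_nbhs_nbhs (conj (@chart_open _ _ _ i) pi)) _.
by apply: (@param_continuous _ _ _ i _ pi); rewrite param_chart.
Qed.

Lemma near_dom i x : dom i x -> \forall y \near x, dom i y.
Proof. by move=> ix; exact: (open_nbhs_nbhs (conj (@dom_open _ _ _ i) ix)). Qed.

Definition trans_dom i j : set 'rV[R]_n := chart i @` (dom i `&` dom j).

Lemma open_trans_dom i j : open (trans_dom i j).
Proof. by apply: open_chart_image; exact: dom_open. Qed.

Lemma trans_dom_chart i j x : dom i x -> dom j x -> trans_dom i j (chart i x).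
Proof. by move=> ix jx; exists x. Qed.

Lemma transition_differentiable i j x : dom i x -> dom j x ->
  differentiable (chart j \o param i) (chart i x).
Proof.
move=> ix jx; have [+ _] := @transition_smooth _ _ M i j 1%N; apply.
exact: trans_dom_chart.
Qed.

Lemma transition_jac_id i x : dom i x -> transition_jac i i x = 1%:M.
Proof.
move=> ix; rewrite /transition_jac -(jacobian_id (chart i x)).
apply: near_eq_jacobian; last exact: transition_differentiable.
by apply: filterS (near_param ix (near_dom ix)) => q [qi _]; rewrite /= chart_param.
Qed.

Lemma transition_jac_mul i j k x : dom i x -> dom j x -> dom k x ->
  transition_jac i j x *m transition_jac j k x = transition_jac i k x.
Proof.
move=> ix jx kx; have dij := transition_differentiable ix jx.
have djk := transition_differentiable jx kx.
have pE : (chart j \o param i) (chart i x) = chart j x by rewrite /= param_chart.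
rewrite -pE in djk.
rewrite /transition_jac -pE; apply: etrans (esym (jacobian_comp dij djk)) _.
apply: near_eq_jacobian; last exact: differentiable_comp dij djk.
apply: filterS (near_param ix (near_dom jx)) => q [qi jq].
by rewrite /= param_chart.
Qed.

Lemma to_chart_trans i j x : dom i x -> dom j x ->
  to_chart i x *m transition_jac i j x = to_chart j x.
Proof. by move=> ix jx; apply: transition_jac_mul => //; exact: chart_atP. Qed.

Lemma of_to_chart i x : dom i x -> of_chart i x *m to_chart i x = 1%:M.
Proof.
move=> ix; rewrite /of_chart /to_chart transition_jac_mul ?transition_jac_id //.
exact: chart_atP.
Qed.

Lemma to_of_chart i x : dom i x -> to_chart i x *m of_chart i x = 1%:M.
Proof.
move=> ix; rewrite /of_chart /to_chart transition_jac_mul ?transition_jac_id //;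
exact: chart_atP.
Qed.

Lemma to_chart_at x : to_chart (chart_at x) x = 1%:M.
Proof. exact/transition_jac_id/chart_atP. Qed.

Lemma of_chart_at x : of_chart (chart_at x) x = 1%:M.
Proof. exact/transition_jac_id/chart_atP. Qed.

End Charts.

(** * The covariant derivative along a map in arbitrary charts *)

Section Along.
Context (R : realType) (n m : nat) (N : manifold R n) (M : manifold R m).
Context (f : N -> M).
Context (fS : smooth_map f).
Implicit Types (i : chart_index N) (j : chart_index M) (x : N) (V : N -> 'rV[R]_m).

Definition along_dom i j : set 'rV[R]_n := chart i @` (dom i `&` f @^-1` dom j).

Definition local_map i j : 'rV[R]_n -> 'rV[R]_m := chart j \o f \o param i.

Lemma open_along_dom i j : open (along_dom i j).
Proof.
apply: open_chart_image; apply: open_comp (@dom_open _ _ _ j) => x _.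
exact: fS.1.
Qed.

Lemma along_domE i j p : along_dom i j p <->
  chart_image i p /\ dom j (f (param i p)).
Proof. exact: chart_imageE. Qed.

Lemma along_dom_chart i j x : dom i x -> dom j (f x) -> along_dom i j (chart i x).
Proof. by move=> ix jx; exists x. Qed.

Lemma smooth_local_map i j : smooth_on (along_dom i j) (local_map i j).
Proof. exact: fS.2. Qed.

Lemma local_map_differentiable i j p : along_dom i j p ->
  differentiable (local_map i j) p.
Proof. by move=> ip; have [+ _] := smooth_local_map i j 1%N; exact. Qed.

Lemma near_along i j p : along_dom i j p -> \forall q \near p, along_dom i j q.
Proof.
by move=> ip; apply: open_nbhs_nbhs; split=> //; exact: open_along_dom.
Qed.

Lemma near_along2 i j i' j' x :
  dom i x -> dom i' x -> dom j (f x) -> dom j' (f x) ->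
  \forall q \near chart i x, [/\ dom i (param i q), dom i' (param i q),
    dom j (f (param i q)) & dom j' (f (param i q))].
Proof.
move=> ix i'x jx j'x.
have h : \forall y \near x, dom i' y /\ (dom j (f y) /\ dom j' (f y)).
  apply: filterI; first exact: near_dom.
  by apply: filterI; apply: (fS.1 x); exact: near_dom.
apply: filterS (near_param ix h) => q [qi [? [? ?]]].
by split=> //; exact: dom_param.
Qed.

(** Near [x], reading [f] in the preferred charts and then changing charts of [M] is the same as
    changing charts of [N] and then reading [f] in [i] and [j]; the identity is the chain rule for
    both composites. *)
Lemma differential_to_chart i j x : dom i x -> dom j (f x) ->
  differential f x *m to_chart j (f x) =
  to_chart i x *m 'J (local_map i j) (chart i x).
Proof.
move=> ix jx; have i0x := chart_atP x; have j0x := chart_atP (f x).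
set i0 := chart_at x in i0x *; set j0 := chart_at (f x) in j0x *.
have d0 := local_map_differentiable (along_dom_chart i0x j0x).
have d1 := local_map_differentiable (along_dom_chart ix jx).
have ds := transition_differentiable j0x jx.
have dt := transition_differentiable i0x ix.
have e0 : local_map i0 j0 (chart i0 x) = chart j0 (f x).
  by rewrite /local_map /= param_chart.
have e1 : (chart i \o param i0) (chart i0 x) = chart i x by rewrite /= param_chart.
have E0 := jacobian_comp d0 (f := local_map i0 j0) (h := chart j \o param j0).
have E1 := jacobian_comp dt (f := chart i \o param i0) (h := local_map i j).
rewrite e0 in E0; rewrite e1 in E1.
apply: etrans (esym (E0 ds)) _; apply: etrans _ (E1 d1).
apply: near_eq_jacobian; last first.
  by apply: differentiable_comp d0 _; rewrite e0.
apply: filterS (near_along2 i0x ix j0x jx) => q [qi0 qi qj0 qj].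
by rewrite /local_map /= !param_chart.
Qed.

Lemma along_push i j (X : N -> 'rV[R]_n) p : along_dom i j p ->
  along_in f i j (push f X) p = field_in i X p *m 'J (local_map i j) p.
Proof.
move=> /along_domE[pi pj]; have ip := dom_param pi.
rewrite /along_in /push /field_in -mulmxA (differential_to_chart ip pj).
by rewrite chart_param // mulmxA.
Qed.

Lemma along_in_at V x :
  along_in f (chart_at x) (chart_at (f x)) V (chart (chart_at x) x) = V x.
Proof.
by rewrite /along_in param_chart ?to_chart_at ?mulmx1 //; exact: chart_atP.
Qed.

Lemma smooth_along_differentiable i j V p : smooth_along f V -> along_dom i j p ->
  differentiable (along_in f i j V) p.
Proof. by move=> sV ip; have [+ _] := sV i j 1%N; exact. Qed.

Context (nabla : connection M).

(* The inhomogeneous term of the christoffel transformation law cancels the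
   derivative of the Jacobian of the change of charts of M. *)
Lemma along_cov_along i j (X : N -> 'rV[R]_n) V p : smooth_along f V ->
  along_dom i j p ->
  along_in f i j (cov_along f nabla X V) p =
  'D_(field_in i X p) (along_in f i j V) p +
  christoffel_apply (christoffel nabla j (local_map i j p))
    (field_in i X p *m 'J (local_map i j) p) (along_in f i j V p).
Proof.
move=> sV /along_domE[pi pj]; have ip := dom_param pi.
move: (param i p) (chart_param pi) ip pj => x <- ix jx {p pi}.
have i0x := chart_atP x; have j0x := chart_atP (f x).
set i0 := chart_at x in i0x *; set j0 := chart_at (f x) in j0x *.
pose t := chart i \o param i0; pose s := chart j \o param j0.
pose p0 := chart i0 x; pose V0 := along_in f i0 j0 V; pose V1 := along_in f i j V.
pose phi0 := local_map i0 j0.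
have dphi0 : differentiable phi0 p0.
  exact: local_map_differentiable (along_dom_chart i0x j0x).
have ds : differentiable s (chart j0 (f x)) by exact: transition_differentiable.
have dt : differentiable t p0 by exact: transition_differentiable.
have e0 : phi0 p0 = chart j0 (f x) by rewrite /phi0 /local_map /= param_chart.
have e1 : t p0 = chart i x by rewrite /t /= param_chart.
have dV0 : differentiable V0 p0.
  exact: smooth_along_differentiable sV (along_dom_chart i0x j0x).
have dV1 : differentiable V1 (t p0).
  by rewrite e1; exact: smooth_along_differentiable sV (along_dom_chart ix jx).
have Cs : Ck_on 2 (trans_dom j0 j) s := @transition_smooth _ _ M j0 j 2%N.
have sx : trans_dom j0 j (chart j0 (f x)) by exact: trans_dom_chart.
have [dJs _] := Ck_on_jacobian (@open_trans_dom _ _ M j0 j) Cs.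
have dJ : differentiable (fun q => 'J s q) (phi0 p0) by rewrite e0; exact: dJs.
have V1E : {near p0, V1 \o t =1 (fun q => V0 q *m 'J s (phi0 q))}.
  apply: filterS (near_along2 i0x ix j0x jx) => q [qi0 qi qj0 qj].
  have pE : param i (t q) = param i0 q := param_chart qi.
  transitivity (V (param i0 q) *m to_chart j (f (param i0 q))).
    by rewrite /comp /V1 /along_in -/(t q) pE.
  by rewrite -(to_chart_trans qj0 qj) mulmxA.
have XE : field_in i X (chart i x) = 'D_(X x) t p0.
  by rewrite /field_in param_chart // deriveEjacobian.
have uE : field_in i X (chart i x) *m 'J (local_map i j) (chart i x) =
    push f X x *m 'J s (chart j0 (f x)).
  by rewrite -along_push /along_in ?param_chart //; exact: along_dom_chart.
have vE : V1 (chart i x) = V x *m 'J s (chart j0 (f x)).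
  by rewrite /V1 /along_in param_chart.
have sE : local_map i j (chart i x) = s (chart j0 (f x)).
  by rewrite /local_map /s /= !param_chart.
have DV : 'D_(field_in i X (chart i x)) V1 (chart i x) =
    'D_(X x) V0 p0 *m 'J s (chart j0 (f x)) +
    'D_(push f X x) (fun q => 'D_(V x) s q) (chart j0 (f x)).
  rewrite XE -e1; apply: etrans (esym (derive_comp (X x) dt dV1)) _.
  apply: etrans (near_eq_derive (X x) V1E) _.
  apply: etrans (derive_mulmx (X x) dV0 (differentiable_comp dphi0 dJ)) _.
  have A : 'D_(X x) V0 p0 *m 'J s (phi0 p0) =
      'D_(X x) V0 p0 *m 'J s (chart j0 (f x)) by rewrite e0.
  have pushE : 'D_(X x) phi0 p0 = push f X x by rewrite deriveEjacobian.
  have B : V0 p0 *m 'D_(X x) ((fun q => 'J s q) \o phi0) p0 =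
      'D_(push f X x) (fun q => 'D_(V x) s q) (chart j0 (f x)).
    rewrite (_ : V0 p0 = V x); last exact: along_in_at.
    apply: etrans (congr1 (mulmx (V x)) (derive_comp (X x) dphi0 dJ)) _.
    rewrite pushE e0.
    exact: (derive_jacobian _ _ (@open_trans_dom _ _ M j0 j) Cs sx).
  exact: (congr2 +%R A B).
rewrite uE sE -/V1 vE DV.
have CT := @christoffel_transition _ _ _ nabla j0 j (f x) (push f X x) (V x) j0x jx.
have L : along_in f i j (cov_along f nabla X V) (chart i x) =
    cov_along f nabla X V x *m 'J s (chart j0 (f x)).
  by rewrite /along_in param_chart.
apply: etrans L (etrans (mulmxDl _ _ _) _).
apply: etrans (congr1 (+%R _) (esym CT)) _.
exact: etrans (congr1 (+%R _) (addrC _ _)) (addrA _ _ _).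
Qed.

End Along.

(** * Inner products given by Gram matrices *)

Section InnerProducts.
Context (R : realType).

Lemma ipDl n (G : 'M[R]_n) u v w : ip G (u + v) w = ip G u w + ip G v w.
Proof. by rewrite /ip !mulmxDl mxE. Qed.

Lemma ipNl n (G : 'M[R]_n) u w : ip G (- u) w = - ip G u w.
Proof. by rewrite /ip !mulNmx mxE. Qed.

Lemma ip_mulmx n k (A : 'M[R]_(k, n)) (G : 'M[R]_n) u v :
  ip (A *m G *m A^T) u v = ip G (u *m A) (v *m A).
Proof. by rewrite /ip trmx_mul !mulmxA. Qed.

Definition posdef n (G : 'M[R]_n) := forall u, u != 0 -> 0 < ip G u u.

Lemma posdef_gram n k (G : 'M[R]_n) (E : 'M[R]_(k, n)) :
  posdef G -> row_free E -> posdef (E *m G *m E^T).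
Proof.
move=> pG fE u u0; rewrite ip_mulmx; apply: pG.
by apply: contra u0 => /eqP uE; apply/eqP/(row_free_inj fE); rewrite uE mul0mx.
Qed.

Lemma posdef_unitmx n (G : 'M[R]_n) : posdef G -> G \in unitmx.
Proof.
move=> pG; rewrite -row_free_unit; apply: inj_row_free => v vG.
apply/eqP; apply: contraT => /pG; rewrite /ip vG mul0mx mxE ltxx.
by [].
Qed.

(** Orthogonal complements are encoded as kernels; this translates them into inner products. For the
    converse it suffices to test the rows of [E]. *)
Lemma sub_kermx_ip n k (u : 'rV[R]_n) (G : 'M[R]_n) (E : 'M[R]_(k, n)) :
  (u <= kermx (G *m E^T))%MS <->
  forall w : 'rV[R]_n, (w <= E)%MS -> ip G u w = 0.
Proof.
split=> [/sub_kermxP uE w /submxP[c ->]|h].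
  by rewrite /ip trmx_mul mulmxA -(mulmxA u) uE mul0mx mxE.
apply/sub_kermxP/rowP => b; rewrite [RHS]mxE -(h _ (row_sub b E)).
by rewrite /ip tr_row [in RHS]colE [in RHS]mulmxA -colE mulmxA [RHS]mxE.
Qed.

End InnerProducts.

(** * Matrix identities behind changes of charts *)

Section ChangeOfBasis.
Context (R : realType) (m n : nat).

Lemma conj_mulmx (v : 'rV[R]_m) (F C O : 'M[R]_m) : C *m O = 1%:M ->
  v *m F *m C = v *m C *m (O *m F *m C).
Proof. by move=> CO; rewrite !mulmxA -(mulmxA v C) CO mulmx1. Qed.

(** In this and the next lemmas [T] plays the role of the differential and [J] of its Jacobian in
    charts; [C], [C'] stand for [to_chart] and [O], [O'] for [of_chart], in the source and in the
    target. *)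
Lemma intertwine_inv (T J : 'M[R]_(n, m)) (C O : 'M[R]_n) (C' O' : 'M[R]_m) :
  T *m C' = C *m J -> O *m C = 1%:M -> C' *m O' = 1%:M -> O *m T = J *m O'.
Proof.
move=> E OC CO'; have := congr1 (fun A => O *m A *m O') E.
by rewrite -!mulmxA CO' mulmx1 (mulmxA O C) OC mul1mx.
Qed.

Lemma gram_intertwine (T J : 'M[R]_(n, m)) (O : 'M[R]_n) (O' g : 'M[R]_m) :
  O *m T = J *m O' ->
  O *m (T *m g *m T^T) *m O^T = J *m (O' *m g *m O'^T) *m J^T.
Proof.
by move=> E; rewrite !mulmxA E -!mulmxA -!trmx_mul E.
Qed.

Lemma unitmx_gram (O G : 'M[R]_n) : O \in unitmx -> G \in unitmx ->
  O *m G *m O^T \in unitmx.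
Proof. by move=> uO uG; rewrite !unitmx_mul unitmx_tr uO uG. Qed.

Lemma tangential_intertwine (T J : 'M[R]_(n, m)) (C O : 'M[R]_n) (O' : 'M[R]_m)
    (v w : 'rV[R]_m) (g : 'M[R]_m) : w *m O' = v ->
  O *m T = J *m O' -> O *m C = 1%:M ->
  T *m g *m T^T \in unitmx ->
  v *m g *m T^T *m invmx (T *m g *m T^T) *m C =
  w *m (O' *m g *m O'^T) *m J^T *m invmx (O *m (T *m g *m T^T) *m O^T).
Proof.
move=> <- E OC; set G := T *m g *m T^T => uG; have [uO uC] := mulmx1_unit OC.
have uH := unitmx_gram uO uG.
apply: (can_inj (mulmxK uH)); rewrite mulmxKV //.
have CO := mulmx1C OC.
clearbody G; rewrite -!mulmxA (mulmxA C) CO mul1mx (mulmxA (invmx G)) mulVmx // mul1mx.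
by rewrite -!trmx_mul E.
Qed.

End ChangeOfBasis.

(** * Smoothness of the constructions along a map *)

Section Smoothness.
Context (R : realType) (n m : nat) (N : manifold R n) (M : manifold R m).
Context (f : N -> M).
Context (fS : smooth_map f).
Implicit Types (i : chart_index N) (j : chart_index M) (x : N)
  (V W : N -> 'rV[R]_m) (X Y : N -> 'rV[R]_n).

Lemma local_map_image i j p : along_dom f i j p ->
  chart_image j (local_map f i j p).
Proof. by move=> [x [ix jx] <-]; exists (f x); rewrite /local_map /= ?param_chart. Qed.

Lemma smooth_christoffel_apply (nabla : connection M) i j k u v :
  Ck_on k (along_dom f i j) u -> Ck_on k (along_dom f i j) v ->
  Ck_on k (along_dom f i j) (fun p =>
    christoffel_apply (christoffel nabla j (local_map f i j p)) (u p) (v p)).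
Proof.
have oA := @open_along_dom _ _ _ _ _ f fS i j.
move=> Cu Cv; apply: Ck_on_sum => // a _; apply: Ck_on_sum => // b _.
apply: Ck_onZ => //; first by apply: Ck_onM => //; exact: Ck_on_coord.
exact: (Ck_on_comp oA (@chart_open _ _ M j) (@local_map_image i j)
  (smooth_local_map fS i j k) (@christoffel_smooth _ _ _ nabla j a b k)).
Qed.

Lemma smooth_field_along X i j k : smooth_field X ->
  Ck_on k (along_dom f i j) (field_in i X).
Proof.
move=> sX; apply: Ck_onS (sX i k) => p [x [ix _] <-].
by exists x.
Qed.

Lemma smooth_jacobian_along i j k :
  Ck_on k (along_dom f i j) (fun p => 'J (local_map f i j) p).
Proof.
apply: Ck_on_jacobian; first exact: open_along_dom.
exact: (smooth_local_map fS i j k.+1).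
Qed.

Lemma smooth_push X : smooth_field X -> smooth_along f (push f X).
Proof.
move=> sX i j k; have oA := @open_along_dom _ _ _ _ _ f fS i j.
apply: (Ck_on_eq (f := fun p => field_in i X p *m 'J (local_map f i j) p)) => //.
  by move=> p /[!inE] pA; rewrite along_push.
apply: Ck_on_mulmx => //; first exact: smooth_field_along.
exact: smooth_jacobian_along.
Qed.

(** [cov_along] is defined through the preferred charts only, but by [along_cov_along] it has the
    same shape in every pair of charts. Since [Ck_on] differentiates in fixed directions, the
    derivative in the varying direction X is written as a product with the Jacobian. *)
Lemma smooth_cov_along (nabla : connection M) X V :
  smooth_field X -> smooth_along f V -> smooth_along f (cov_along f nabla X V).
Proof.
move=> sX sV i j k; have oA := @open_along_dom _ _ _ _ _ f fS i j.
have CX := smooth_field_along i j k sX; have CJ := smooth_jacobian_along i j k.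
have CV := sV i j k.
apply: (Ck_on_eq (f := fun p => field_in i X p *m 'J (along_in f i j V) p +
  christoffel_apply (christoffel nabla j (local_map f i j p))
    (field_in i X p *m 'J (local_map f i j) p) (along_in f i j V p))) => //.
  move=> p /[!inE] pA; rewrite along_cov_along // deriveEjacobian //.
  exact: smooth_along_differentiable sV pA.
apply: (Ck_onD oA).
  exact: (Ck_on_mulmx oA CX (Ck_on_jacobian oA (sV i j k.+1))).
exact: (smooth_christoffel_apply nabla (Ck_on_mulmx oA CX CJ) CV).
Qed.

Lemma smooth_alongB V W : smooth_along f V -> smooth_along f W ->
  smooth_along f (fun x => V x - W x).
Proof.
move=> sV sW i j k; have oA := @open_along_dom _ _ _ _ _ f fS i j.
apply: (Ck_on_eq (f := fun p => along_in f i j V p + - along_in f i j W p)) => //.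
  by move=> p _; rewrite /along_in mulmxBl.
by apply: Ck_onD => //; [exact: sV|apply: Ck_onN => //; exact: sW].
Qed.

Lemma smooth_form_along (g : M -> 'M[R]_m) i j k : smooth_form g ->
  Ck_on k (along_dom f i j) (fun p => form_in j g (local_map f i j p)).
Proof.
move=> sg; have oA := @open_along_dom _ _ _ _ _ f fS i j.
exact: (Ck_on_comp oA (@chart_open _ _ M j) (@local_map_image i j)
  (smooth_local_map fS i j k) (sg j k)).
Qed.

Lemma smooth_endo_along (F : M -> 'M[R]_m) i j k : smooth_endo F ->
  Ck_on k (along_dom f i j) (fun p => endo_in j F (local_map f i j p)).
Proof.
move=> sF; have oA := @open_along_dom _ _ _ _ _ f fS i j.
exact: (Ck_on_comp oA (@chart_open _ _ M j) (@local_map_image i j)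
  (smooth_local_map fS i j k) (sF j k)).
Qed.

Lemma param_local_map i j p : along_dom f i j p ->
  param j (local_map f i j p) = f (param i p).
Proof. by move=> /along_domE[_ pj]; rewrite /local_map /= param_chart. Qed.

Lemma along_endo (F : M -> 'M[R]_m) i j V p : along_dom f i j p ->
  along_in f i j (fun y => V y *m F (f y)) p =
  along_in f i j V p *m endo_in j F (local_map f i j p).
Proof.
move=> pA; have /along_domE[_ pj] := pA.
rewrite /along_in /endo_in param_local_map //.
exact: conj_mulmx (to_of_chart pj).
Qed.

Lemma smooth_along_endo (F : M -> 'M[R]_m) V : smooth_endo F ->
  smooth_along f V -> smooth_along f (fun x => V x *m F (f x)).
Proof.
move=> sF sV i j k; have oA := @open_along_dom _ _ _ _ _ f fS i j.
apply: (Ck_on_eq (f := fun p =>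
  along_in f i j V p *m endo_in j F (local_map f i j p))) => //.
  by move=> p /[!inE] pA; rewrite along_endo.
by apply: Ck_on_mulmx => //; [exact: sV|exact: smooth_endo_along].
Qed.

Lemma of_chart_differential i j x : dom i x -> dom j (f x) ->
  of_chart i x *m differential f x =
  'J (local_map f i j) (chart i x) *m of_chart j (f x).
Proof.
move=> ix jx; have E := differential_to_chart fS ix jx.
exact: intertwine_inv E (of_to_chart ix) (to_of_chart jx).
Qed.

Lemma form_in_induced (g : M -> 'M[R]_m) i j p : along_dom f i j p ->
  form_in i (induced_metric f g) p = 'J (local_map f i j) p *m
    form_in j g (local_map f i j p) *m ('J (local_map f i j) p)^T.
Proof.
move=> pA; have /along_domE[pi pj] := pA; have ip := dom_param pi.
have E := of_chart_differential ip pj; rewrite chart_param // in E.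
rewrite /form_in /induced_metric param_local_map //.
exact: gram_intertwine E.
Qed.

Lemma along_of_chart i j V p : along_dom f i j p ->
  along_in f i j V p *m of_chart j (f (param i p)) = V (param i p).
Proof.
move=> /along_domE[_ pj]; rewrite /along_in.
exact: etrans (esym (mulmxA _ _ _)) (etrans (congr1 (mulmx _) (to_of_chart pj))
  (mulmx1 _)).
Qed.

Context (g : M -> 'M[R]_m).
Context (gR : riemannian_metric g) (fI : forall x, row_free (differential f x)).

Lemma induced_posdef x : posdef (induced_metric f g x).
Proof. by apply: posdef_gram => // u; have [_ _] := gR; apply. Qed.

Lemma field_in_tangential i j V p : along_dom f i j p ->
  field_in i (fun x => tangential f g x (V x)) p =
  along_in f i j V p *m form_in j g (local_map f i j p) *m
    ('J (local_map f i j) p)^T *m invmx (form_in i (induced_metric f g) p).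
Proof.
move=> pA; have /along_domE[pi pj] := pA; have ip := dom_param pi.
have E := of_chart_differential ip pj; rewrite chart_param // in E.
have uG := posdef_unitmx (induced_posdef (param i p)).
apply: etrans (tangential_intertwine (along_of_chart V pA) E (of_to_chart ip) uG) _.
by rewrite /form_in param_local_map.
Qed.

Lemma smooth_form_induced : smooth_form (induced_metric f g).
Proof.
have [sg _ _] := gR.
(* A chart domain of [N] need not be mapped into a single chart domain of [M], so the chart [j] is
   chosen for each point. *)
move=> i k; apply: Ck_on_pointwise => p pi.
pose j := chart_at (f (param i p)).
have pA : along_dom f i j p by apply/along_domE; split=> //; exact: chart_atP.
have oA := @open_along_dom _ _ _ _ _ f fS i j.
apply: (@Ck_onS _ _ _ _ (along_dom f i j)); first by move=> _ ->.
have CJ := smooth_jacobian_along i j k.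
apply: (Ck_on_eq (f := fun p => 'J (local_map f i j) p *m
    form_in j g (local_map f i j p) *m ('J (local_map f i j) p)^T)) => //.
  by move=> q /[!inE] qA; rewrite (form_in_induced g qA).
exact: (Ck_on_mulmx oA (Ck_on_mulmx oA CJ (smooth_form_along i j k sg))
  (Ck_on_trmx oA CJ)).
Qed.

Lemma smooth_tangential V : smooth_along f V ->
  smooth_field (fun x => tangential f g x (V x)).
Proof.
have [sg _ _] := gR.
move=> sV i k; apply: Ck_on_pointwise => p /chart_imageE[pi _].
pose j := chart_at (f (param i p)).
have pA : along_dom f i j p by apply/along_domE; split=> //; exact: chart_atP.
have oA := @open_along_dom _ _ _ _ _ f fS i j.
apply: (@Ck_onS _ _ _ _ (along_dom f i j)); first by move=> _ ->.
apply: (Ck_on_eq (f := fun p => along_in f i j V p *m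
  form_in j g (local_map f i j p) *m ('J (local_map f i j) p)^T *m
  invmx (form_in i (induced_metric f g) p))) => //.
  by move=> q /[!inE] qA; rewrite (field_in_tangential V qA).
have CJ := smooth_jacobian_along i j k.
apply: (Ck_on_mulmx oA); last first.
  apply: (Ck_on_invmx oA).
    move=> q /along_domE[qi qj].
    have [uO _] := mulmx1_unit (of_to_chart (dom_param qi)).
    exact: unitmx_gram uO (posdef_unitmx (induced_posdef _)).
  by apply: Ck_onS (smooth_form_induced i k) => q /along_domE[].
exact: (Ck_on_mulmx oA (Ck_on_mulmx oA (sV i j k)
  (smooth_form_along i j k sg)) (Ck_on_trmx oA CJ)).
Qed.

End Smoothness.

Section DeriveIp.
Context (R : realType) (V : normedModType R) (n : nat).

Lemma ipDr (G : 'M[R]_n) u v w : ip G u (v + w) = ip G u v + ip G u w.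
Proof. by rewrite /ip linearD mulmxDr mxE. Qed.

Lemma derive_ip (G : V -> 'M[R]_n) (A B : V -> 'rV[R]_n) (p v : V) :
  differentiable G p -> differentiable A p -> differentiable B p ->
  'D_v (fun q => ip (G q) (A q) (B q) : R^o) p =
  ip (G p) ('D_v A p) (B p) + ip ('D_v G p) (A p) (B p) +
  ip (G p) (A p) ('D_v B p).
Proof.
move=> dG dA dB; have dAG := differentiable_mulmx dA dG.
have dBt := differentiable_trmx dB; have dAGB := differentiable_mulmx dAG dBt.
apply: etrans (esym (derive_coord v 0 0 dAGB)) _.
rewrite (derive_mulmx v dAG dBt) (derive_mulmx v dA dG) (derive_trmx v dB).
by rewrite /ip mulmxDl mxE [X in X + _]mxE.
Qed.

Lemma derive_ip_form (G : V -> 'M[R]_n) (a b : 'rV[R]_n) (p v : V) :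
  differentiable G p ->
  'D_v (fun q => ip (G q) a b : R^o) p = ip ('D_v G p) a b.
Proof.
move=> dG; have da := differentiable_cst a p; have db := differentiable_cst b p.
rewrite (derive_ip v dG da db) (derive_cst a p v) (derive_cst b p v).
by rewrite /ip trmx0 mulmx0 !mul0mx !mxE add0r addr0.
Qed.

End DeriveIp.

(** * Metric compatibility, parallelism and torsion on constant fields *)

Section ConstantFields.
Context (R : realType) (m : nat) (M : manifold R m) (nabla : connection M).
Implicit Types (j : chart_index M) (p u v w : 'rV[R]_m).

Lemma smooth_cst (U : set 'rV[R]_m) (c : 'rV[R]_m) : smooth_on U (fun=> c).
Proof. by move=> k; exact: Ck_on_cst. Qed.

Lemma local_cov_cst j p u v :
  local_cov nabla j (fun=> u) (fun=> v) p =
  christoffel_apply (christoffel nabla j p) u v.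
Proof. by rewrite /local_cov (derive_cst v p u) add0r. Qed.

(** For fields with constant components only the Gram matrix is differentiated. What remains is an
    identity at a single point, which no longer mentions fields on [M]. *)
Lemma metric_compatible_cst (g : M -> 'M[R]_m) j p u v w : smooth_form g ->
  metric_compatible g nabla -> chart_image j p ->
  ip ('D_u (form_in j g) p) v w =
  ip (form_in j g p) (christoffel_apply (christoffel nabla j p) u v) w +
  ip (form_in j g p) v (christoffel_apply (christoffel nabla j p) u w).
Proof.
move=> sg mc jp; have [dg _] := sg j 1%N.
have E := mc j (fun=> u) (fun=> v) (fun=> w) (smooth_cst _ u) (smooth_cst _ v)
  (smooth_cst _ w) p jp.
rewrite !local_cov_cst in E.
exact: etrans (esym (derive_ip_form v w u (dg p jp))) E.
Qed.

Lemma parallel_endo_cst (F : M -> 'M[R]_m) j p u v : smooth_endo F ->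
  parallel_endo nabla F -> chart_image j p ->
  v *m 'D_u (endo_in j F) p +
    christoffel_apply (christoffel nabla j p) u (v *m endo_in j F p) =
  christoffel_apply (christoffel nabla j p) u v *m endo_in j F p.
Proof.
move=> sF pF jp; have [dF _] := sF j 1%N.
have E := pF j (fun=> u) (fun=> v) (smooth_cst _ u) (smooth_cst _ v) p jp.
rewrite local_cov_cst in E; apply: etrans _ E.
by rewrite -(derive_lin_mulmx v u (dF p jp)).
Qed.

Lemma christoffel_apply_sym j p u v : torsion_free nabla -> chart_image j p ->
  christoffel_apply (christoffel nabla j p) u v =
  christoffel_apply (christoffel nabla j p) v u.
Proof.
move=> tf jp.
have := tf j (fun=> u) (fun=> v) (smooth_cst _ u) (smooth_cst _ v) p jp.
rewrite !local_cov_cst /local_lie (derive_cst v p u) (derive_cst u p v) subrr.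
by move/eqP; rewrite subr_eq0 => /eqP.
Qed.

Lemma ip_form_in (g : M -> 'M[R]_m) j (y : M) u v : dom j y ->
  ip (form_in j g (chart j y)) (u *m to_chart j y) (v *m to_chart j y) =
  ip (g y) u v.
Proof.
move=> jy; rewrite /form_in param_chart //.
move: (to_of_chart jy); move: (to_chart j y) (of_chart j y) => C O CO.
by rewrite ip_mulmx -!mulmxA CO !mulmx1.
Qed.

Lemma form_in_at (g : M -> 'M[R]_m) y :
  form_in (chart_at y) g (chart (chart_at y) y) = g y.
Proof.
have jy := chart_atP y.
by rewrite /form_in param_chart // of_chart_at trmx1 mul1mx mulmx1.
Qed.

Lemma endo_in_at (F : M -> 'M[R]_m) y :
  endo_in (chart_at y) F (chart (chart_at y) y) = F y.
Proof.
have jy := chart_atP y.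
by rewrite /endo_in param_chart // of_chart_at to_chart_at mul1mx mulmx1.
Qed.

End ConstantFields.

(** * Product rules along a map *)

Section CovAlong.
Context (R : realType) (n m : nat) (N : manifold R n) (M : manifold R m).
Context (f : N -> M) (nabla : connection M).
Context (fS : smooth_map f).
Implicit Types (x : N) (V W : N -> 'rV[R]_m) (X Y : N -> 'rV[R]_n).

Lemma push_derive x X : push f X x =
  'D_(X x) (local_map f (chart_at x) (chart_at (f x))) (chart (chart_at x) x).
Proof.
have pA := along_dom_chart (chart_atP x) (chart_atP (f x)).
exact: esym (deriveEjacobian (X x) (local_map_differentiable fS pA)).
Qed.

Lemma local_map_at x : local_map f (chart_at x) (chart_at (f x))
  (chart (chart_at x) x) = chart (chart_at (f x)) (f x).
Proof. by rewrite /local_map /= param_chart //; exact: chart_atP. Qed.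

(** The product rule has three terms. The one that differentiates the Gram matrix becomes, by the
    chain rule, its derivative in the direction [push f X x], and [metric_compatible_cst] splits it
    into the two Christoffel terms that complete the other derivatives to covariant ones. *)
Lemma metric_along (g : M -> 'M[R]_m) X V W x : smooth_form g ->
  metric_compatible g nabla -> smooth_along f V -> smooth_along f W ->
  'D_(X x) (fun q => ip (g (f (param (chart_at x) q))) (V (param (chart_at x) q))
    (W (param (chart_at x) q)) : R^o) (chart (chart_at x) x) =
  ip (g (f x)) (cov_along f nabla X V x) (W x) +
  ip (g (f x)) (V x) (cov_along f nabla X W x).
Proof.
move=> sg mc sV sW; have ix := chart_atP x; have jx := chart_atP (f x).
have pA := along_dom_chart ix jx; have pushE := push_derive x X.
have phi0 := local_map_at x.
have VE := along_in_at f V x; have WE := along_in_at f W x.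
have gE := form_in_at g (f x).
rewrite /cov_along; set i := chart_at x in ix pA pushE phi0 VE WE *.
set j := chart_at (f x) in jx pA pushE phi0 VE WE gE *.
set p := chart i x in pA pushE phi0 VE WE *.
set u := push f X x in pushE *.
pose phi := local_map f i j; rewrite -/phi in phi0 pushE.
have jim : chart_image j (chart j (f x)) by exact: chart_image_chart.
have dphi : differentiable phi p := local_map_differentiable fS pA.
have dg : differentiable (form_in j g) (phi p).
  by rewrite phi0; have [+ _] := sg j 1%N; exact.
have dG := differentiable_comp dphi dg.
have dV := smooth_along_differentiable sV pA.
have dW := smooth_along_differentiable sW pA.
have near_ip : {near p, (fun q => ip (form_in j g (phi q)) (along_in f i j V q)
    (along_in f i j W q)) =1 (fun q => ip (g (f (param i q))) (V (param i q))
    (W (param i q)))}.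
  apply: filterS (near_along fS pA) => q /along_domE[qi qj].
  exact: (ip_form_in g (V (param i q)) (W (param i q)) qj).
apply: etrans (esym (near_eq_derive (X x) near_ip)) _.
apply: etrans (derive_ip (X x) dG dV dW) _.
have DG : 'D_(X x) (form_in j g \o phi) p = 'D_u (form_in j g) (chart j (f x)).
  apply: etrans (derive_comp (X x) dphi dg) _.
  by rewrite pushE phi0.
have mcE := metric_compatible_cst u (V x) (W x) sg mc jim.
rewrite gE in mcE.
have GE : (form_in j g \o phi) p = g (f x) by rewrite /comp phi0.
rewrite DG GE VE WE mcE; set DV := 'D_(X x) _ p; set DW := 'D_(X x) _ p.
rewrite ipDl ipDr -!addrA; congr (_ + (_ + _)); exact: addrC.
Qed.

(** The same mechanism as for the metric: the derivative of [F] along [f] is exchanged for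
    Christoffel terms by [parallel_endo_cst]. *)
Lemma parallel_along (F : M -> 'M[R]_m) X V x : smooth_endo F ->
  parallel_endo nabla F -> smooth_along f V ->
  cov_along f nabla X (fun y => V y *m F (f y)) x =
  cov_along f nabla X V x *m F (f x).
Proof.
move=> sF pF sV; have ix := chart_atP x; have jx := chart_atP (f x).
have pA := along_dom_chart ix jx; have pushE := push_derive x X.
have phi0 := local_map_at x.
have VE := along_in_at f V x.
have FE := endo_in_at F (f x).
rewrite /cov_along; set i := chart_at x in ix pA pushE phi0 VE *.
set j := chart_at (f x) in jx pA pushE phi0 VE FE *.
set p := chart i x in pA pushE phi0 VE *.
set u := push f X x in pushE *.
pose phi := local_map f i j; rewrite -/phi in phi0 pushE.
have jim : chart_image j (chart j (f x)) by exact: chart_image_chart.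
have dphi : differentiable phi p := local_map_differentiable fS pA.
have dF : differentiable (endo_in j F) (phi p).
  by rewrite phi0; have [+ _] := sF j 1%N; exact.
have dFphi := differentiable_comp dphi dF.
have dV := smooth_along_differentiable sV pA.
have nearE : {near p, along_in f i j (fun y => V y *m F (f y)) =1
    (fun q => along_in f i j V q *m endo_in j F (phi q))}.
  apply: filterS (near_along fS pA) => q qA.
  exact: (along_endo F V qA).
have DE : 'D_(X x) (along_in f i j (fun y => V y *m F (f y))) p =
    'D_(X x) (along_in f i j V) p *m F (f x) +
    V x *m 'D_u (endo_in j F) (chart j (f x)).
  apply: etrans (near_eq_derive (X x) nearE) _.
  apply: etrans (derive_mulmx (X x) dV dFphi) _.
  have DF : 'D_(X x) (endo_in j F \o phi) p = 'D_u (endo_in j F) (chart j (f x)).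
    apply: etrans (derive_comp (X x) dphi dF) _.
    by rewrite pushE phi0.
  have Fp : (endo_in j F \o phi) p = F (f x) by rewrite /comp phi0.
  by rewrite DF Fp VE.
have pE := parallel_endo_cst u (V x) sF pF jim; rewrite FE in pE.
apply: etrans (congr1 (fun A => A + _) DE) _.
by rewrite mulmxDl -pE addrA.
Qed.

End CovAlong.

(* The Levi-Civita connection of N is treated as the covariant derivative along
   the identity of N. *)
Section Identity.
Context (R : realType) (n : nat) (N : manifold R n).

Lemma smooth_id : smooth_map (@id N).
Proof.
split=> [x|i j]; first exact: cvg_id.
exact: transition_smooth.
Qed.

Lemma smooth_along_id (X : N -> 'rV[R]_n) : smooth_field X <-> smooth_along id X.
Proof.
split=> sX i => [j k|k].
  pose t := chart j \o param i.
  have oT := @open_trans_dom _ _ N i j.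
  change (Ck_on k (trans_dom i j) (along_in id i j X)).
  apply: (Ck_on_eq (f := fun p => field_in i X p *m 'J t p) oT).
    move=> p; rewrite inE => /chart_imageE[pi pj].
    have E := to_chart_trans (dom_param pi) pj.
    have JE : transition_jac i j (param i p) = 'J t p :=
      congr1 (fun q => 'J t q) (chart_param pi).
    rewrite JE in E.
    exact: etrans (esym (mulmxA _ _ _)) (congr1 (mulmx _) E).
  apply: (Ck_on_mulmx oT).
    by apply: Ck_onS (sX i k) => p [x [ix _] <-]; exists x.
  apply: (Ck_on_jacobian oT); exact: (@transition_smooth _ _ N i j k.+1).
apply: Ck_onS (sX i i k) => p [x [ix _] <-].
by exists x.
Qed.

Lemma differential_id (x : N) : differential (@id N) x = 1%:M.
Proof. exact/transition_jac_id/chart_atP. Qed.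

Lemma cov_id (nabla : connection N) X Y (x : N) :
  cov nabla X Y x = cov_along id nabla X Y x.
Proof.
have ix := chart_atP x.
rewrite /cov /local_cov /cov_along /push differential_id mulmx1.
have E Z : field_in (chart_at x) Z (chart (chart_at x) x) = Z x.
  by rewrite /field_in param_chart // to_chart_at mulmx1.
by rewrite !E.
Qed.

Lemma smooth_cov (nabla : connection N) X Y :
  smooth_field X -> smooth_field Y -> smooth_field (cov nabla X Y).
Proof.
move=> sX sY; apply/smooth_along_id.
have := smooth_cov_along smooth_id nabla sX ((smooth_along_id Y).1 sY).
by congr smooth_along; apply/funext => x; rewrite cov_id.
Qed.

End Identity.

(** * Torsion and extension of vector fields *)

Lemma subr_common (V : zmodType) (a b c d : V) :
  a + c + d - (b + c + d) = a - b.
Proof. by rewrite opprD addrACA subrr addr0 opprD addrACA subrr addr0. Qed.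

Section Torsion.
Context (R : realType) (n m : nat) (N : manifold R n) (M : manifold R m).
Context (f : N -> M) (nablaM : connection M) (nablaN : connection N).
Context (fS : smooth_map f).
Implicit Types (x : N) (X Y : N -> 'rV[R]_n).

Lemma field_in_at k (X : N -> 'M[R]_(k, n)) x :
  field_in (chart_at x) X (chart (chart_at x) x) = X x.
Proof.
have ix := chart_atP x.
by rewrite /field_in param_chart // to_chart_at mulmx1.
Qed.

Lemma smooth_field_chart X i : smooth_field X ->
  smooth_on (chart_image i) (field_in i X).
Proof. by move=> sX k; apply: Ck_onS (sX i k) => p [x ix <-]; exists x. Qed.

Lemma cov_torsion X Y x : torsion_free nablaN ->
  smooth_field X -> smooth_field Y ->
  cov nablaN X Y x - cov nablaN Y X x =
  'D_(X x) (field_in (chart_at x) Y) (chart (chart_at x) x) -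
  'D_(Y x) (field_in (chart_at x) X) (chart (chart_at x) x).
Proof.
move=> tf sX sY; set i := chart_at x.
have := tf i _ _ (smooth_field_chart i sX) (smooth_field_chart i sY) (chart i x)
  (chart_image_chart (chart_atP x)).
by rewrite /local_lie !field_in_at.
Qed.

(** The Christoffel terms of [M] cancel by symmetry, and so do the terms in which the Jacobian of
    [f] is differentiated, a Hessian. What is left is the push-forward of the coordinate bracket,
    which the vanishing torsion of [nablaN] expresses through covariant derivatives. *)
Lemma torsion_along X Y x : torsion_free nablaM -> torsion_free nablaN ->
  smooth_field X -> smooth_field Y ->
  cov_along f nablaM X (push f Y) x - cov_along f nablaM Y (push f X) x =
  push f (fun y => cov nablaN X Y y - cov nablaN Y X y) x.
Proof.
move=> tM tN sX sY; have ix := chart_atP x; have jx := chart_atP (f x).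
have pA := along_dom_chart ix jx.
rewrite {3}/push (cov_torsion x tN sX sY).
have XE := field_in_at X x; have YE := field_in_at Y x.
rewrite /cov_along.
have -> : differential f x =
  'J (local_map f (chart_at x) (chart_at (f x))) (chart (chart_at x) x) by [].
set i := chart_at x in ix pA XE YE *; set j := chart_at (f x) in jx pA *.
set p := chart i x in pA XE YE *; pose phi := local_map f i j.
have dphi := local_map_differentiable fS pA.
have [dJ _] := Ck_on_jacobian (@open_along_dom _ _ _ _ _ f fS i j)
  (smooth_local_map fS i j 2%N).
have dJp := dJ p pA.
have dfield Z : smooth_field Z -> differentiable (field_in i Z) p.
  move=> sZ; have [+ _] := smooth_field_chart i sZ 1%N; apply.
  exact: chart_image_chart.
have DE (u : 'rV[R]_n) Z (z : 'rV[R]_n) : smooth_field Z -> field_in i Z p = z ->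
    'D_u (along_in f i j (push f Z)) p =
    'D_u (field_in i Z) p *m 'J phi p + z *m 'D_u (fun q => 'J phi q) p.
  move=> sZ <-; apply: etrans (derive_mulmx u (dfield Z sZ) dJp).
  apply: near_eq_derive; apply: filterS (near_along fS pA) => q qA.
  exact: along_push.
have jim : chart_image j (chart j (f x)) by exact: chart_image_chart.
have G := christoffel_apply_sym (push f X x) (push f Y x) tM jim.
have S := derive_jacobian_sym (X x) (Y x) (@open_along_dom _ _ _ _ _ f fS i j)
  (smooth_local_map fS i j 2%N) pA.
rewrite (DE _ Y (Y x) sY YE) (DE _ X (X x) sX XE) G S mulmxBl.
exact: subr_common.
Qed.

End Torsion.

(** * Global extension of local fields and of tangent vectors *)

Section Extension.
Context (R : realType) (n : nat) (N : manifold R n).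
Implicit Types (i j : chart_index N) (x y : N) (X Y : N -> 'rV[R]_n) (U : set N).

Lemma closed_ball_nbhs (p : 'rV[R]_n) (O : set 'rV[R]_n) : open O -> O p ->
  exists2 r : R, 0 < r & forall q, `|p - q| <= r -> O q.
Proof.
move=> oO Op; have /nbhs_ballP[r /= r0 rO] := open_nbhs_nbhs (conj oO Op).
exists (r / 2); first by rewrite divr_gt0.
move=> q pq; apply: rO; rewrite -ball_normE /=; apply: le_lt_trans pq _.
by rewrite ltr_pdivrMr // ltr_pMr // ltr1n.
Qed.

Lemma compact_norm_ball (p : 'rV[R]_n) (r : R) : compact [set q | `|p - q| <= r].
Proof.
apply: bounded_closed_compact.
  exists (`|p| + r); split; first exact: num_real.
  move=> s rs q /= pq; apply: le_trans (ltW rs).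
  have -> : q = p - (p - q) by rewrite opprB addrC subrK.
  by rewrite (le_trans (ler_normB _ _)) // lerD.
exact: (@closed_closed_ball_ R 'rV[R]_n p r).
Qed.

(** [Y] is multiplied by a bump function that vanishes off a closed ball in a chart. The image [K]
    of the ball is compact, hence closed because [N] is Hausdorff, so the product vanishes on an
    open set outside [K]. The last clause keeps the extension inside any field of subspaces that
    contains [Y] on [U]. *)
Lemma extend_field U x Y : open U -> U x -> smooth_field_on U Y ->
  exists X, [/\ smooth_field X, X x = Y x &
    forall y, exists2 c, X y = c *: Y y & U y \/ c = 0].
Proof.
move=> oU Ux sY; have ix := chart_atP x; set i := chart_at x in ix.
pose O := chart i @` (dom i `&` U).
have oO : open O by exact: open_chart_image.
have Op : O (chart i x) by exists x.
have [r r0 rO] := closed_ball_nbhs oO Op.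
have [b [sb bp br]] := bump_function (chart i x) r0.
pose K := param i @` [set q | `|chart i x - q| <= r].
have cK : closed K.
  apply: compact_closed; first exact: mhausdorff.
  apply: continuous_compact; last exact: compact_norm_ball.
  apply: continuous_in_subspaceT => q; rewrite inE => /rO /chart_imageE[qi _].
  exact: param_continuous.
have KU y : K y -> dom i y /\ U y.
  by move=> [q /rO/chart_imageE[qi Uq] <-]; split=> //; exact: dom_param.
(* Off [dom i] the value [chart i y] is arbitrary, hence the explicit default 0. *)
pose c y := if `[< dom i y >] then b (chart i y) else 0.
have cE y : dom i y -> c y = b (chart i y) by move=> iy; rewrite /c asboolT.
have c0 y : ~ K y -> c y = 0.
  move=> Ky; rewrite /c; case: asboolP => // iy.
  apply/eqP; apply: contra_notT Ky => /br h.
  by exists (chart i y) => //; rewrite param_chart.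
exists (fun y => c y *: Y y); split.
- move=> j k; apply: Ck_on_pointwise => p /chart_imageE[pj _].
  have [Kp|Kp] := pselect (K (param j p)).
    have [ip Up] := KU _ Kp.
    pose O' := chart j @` (dom j `&` (U `&` dom i)).
    have oO' : open O'.
      by apply: open_chart_image; apply: openI => //; exact: dom_open.
    apply: (@Ck_onS _ _ _ _ O'); first by move=> _ ->; apply/chart_imageE.
    apply: (Ck_on_eq (f := fun q => (b \o (chart i \o param j)) q *: field_in j Y q)) => //.
      move=> q; rewrite inE => /chart_imageE[qj [Uq iq]].
      by rewrite /field_in cE // scalemxAl.
    apply: (Ck_onZ oO').
      apply: (Ck_on_comp_scalar oO' _ _ (sb k)) => //.
      apply: Ck_onS (@transition_smooth _ _ N j i k) => q [y [jy [_ iy]] <-].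
      by exists y.
    by apply: Ck_onS (sY j k) => q [y [jy [Uy _]] <-]; exists y.
  pose O' := chart j @` (dom j `&` ~` K).
  have oO' : open O' by apply: open_chart_image; exact: closed_openC.
  apply: (@Ck_onS _ _ _ _ O'); first by move=> _ ->; apply/chart_imageE.
  apply: (Ck_on_eq (f := fun=> 0) oO'); last exact: Ck_on_cst.
  move=> q; rewrite inE => /chart_imageE[qj Kq].
  by rewrite /field_in c0 // scale0r mul0mx.
- by rewrite cE // bp scale1r.
- move=> y; exists (c y) => //.
  have [Ky|/c0] := pselect (K y); last by right.
  by left; have [] := KU y Ky.
Qed.

Lemma smooth_const_field i (z : 'rV[R]_n) :
  smooth_field_on (dom i) (fun y => z *m of_chart i y).
Proof.
move=> j k; have oT := @open_trans_dom _ _ N j i.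
change (Ck_on k (trans_dom j i) (field_in j (fun y => z *m of_chart i y))).
pose s := chart i \o param j; pose t := chart j \o param i.
apply: (Ck_on_eq (f := fun q => z *m ((fun r => 'J t r) \o s) q) oT).
  move=> q; rewrite inE => /chart_imageE[qj iq].
  have jq := dom_param qj.
  have E := transition_jac_mul iq (chart_atP (param j q)) jq.
  exact: etrans (congr1 (mulmx z) (esym E)) (mulmxA _ _ _).
apply: (Ck_on_mulmx oT (Ck_on_cst _ _ _)).
apply: (Ck_on_comp oT (@open_trans_dom _ _ N i j)
  _ (@transition_smooth _ _ N j i k)
  (Ck_on_jacobian (@open_trans_dom _ _ N i j) (@transition_smooth _ _ N i j k.+1))).
move=> q /chart_imageE[qj iq]; apply/chart_imageE; split.
  exact: chart_image_chart.
by rewrite /s /= param_chart //; exact: dom_param.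
Qed.

Lemma field_through x (z : 'rV[R]_n) : exists2 X, smooth_field X & X x = z.
Proof.
have [X [sX Xx _]] := extend_field (@dom_open _ _ N (chart_at x)) (chart_atP x)
  (smooth_const_field (chart_at x) z).
by exists X => //; rewrite Xx of_chart_at mulmx1.
Qed.

(** The combination of a local frame with constant coefficients is a local section; the cut-off
    makes it global. *)
Lemma section_through D x (z : 'rV[R]_n) : tangent_distribution D ->
  (z <= D x)%MS -> exists2 X, section_of D X & X x = z.
Proof.
move=> tD zD; have [k [U [E [oU Ux sE ED]]]] := tD x.
have [_ /eqmxP Ex] := ED x Ux.
have /submxP[w wE] : (z <= E x)%MS by rewrite Ex.
have sY : smooth_field_on U (fun y => w *m E y).
  move=> j l; have oO := @open_chart_image _ _ N j U oU.
  apply: (Ck_on_eq (f := fun q => w *m field_in j E q) oO).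
    by move=> q _; rewrite /field_in mulmxA.
  exact: (Ck_on_mulmx oO (Ck_on_cst _ _ _) (sE j l)).
have [X [sX Xx XE]] := extend_field oU Ux sY.
exists X; last by rewrite Xx wE.
split=> // y; have [c -> [Uy|->]] := XE y; last by rewrite scale0r sub0mx.
have [_ /eqmxP Ey] := ED y Uy.
by rewrite scalemx_sub // -Ey submxMl.
Qed.

End Extension.

(** * Sections of an orthogonal complement *)

Section OrthogonalProjection.
Context (R : realType) (n k : nat).
Implicit Types (G C O : 'M[R]_n) (E : 'M[R]_(k, n)) (z : 'rV[R]_n).

(** For a frame [E] with invertible Gram matrix, this is [z] minus its component in the span of [E].
    The explicit inverse makes smooth dependence on all data visible. *)
Definition orth_proj G E z : 'rV[R]_n :=
  z - z *m G *m E^T *m invmx (E *m G *m E^T) *m E.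

Lemma orth_proj_orthogonal G E z : E *m G *m E^T \in unitmx ->
  orth_proj G E z *m (G *m E^T) = 0.
Proof.
move=> uE; rewrite mulmxBl mulmxA -!mulmxA (mulmxA E) mulVmx // mulmx1.
by rewrite subrr.
Qed.

Lemma orth_proj_id G E z : z *m (G *m E^T) = 0 -> orth_proj G E z = z.
Proof. by move=> zE; rewrite /orth_proj -(mulmxA z) zE !mul0mx subr0. Qed.

(** Naturality under a change of basis: in any chart the projection is the same formula in the chart
    expressions of its arguments. *)
Lemma orth_proj_basis G E C O z : C *m O = 1%:M ->
  orth_proj G E z *m C = orth_proj (O *m G *m O^T) (E *m C) (z *m C).
Proof.
move=> CO.
have COt : O^T *m C^T = 1%:M by rewrite -trmx_mul CO trmx1.
have K l (A : 'M[R]_(l, n)) :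
    A *m C *m (O *m G *m O^T) *m (E *m C)^T = A *m G *m E^T.
  rewrite trmx_mul !mulmxA -(mulmxA A C) CO mulmx1.
  by rewrite -(mulmxA _ O^T) COt mulmx1.
by rewrite /orth_proj !K mulmxBl !mulmxA.
Qed.

Lemma kermx_sub_orth l G E (D : 'M[R]_(l, n)) z : (D <= E)%MS ->
  z *m (G *m E^T) = 0 -> (z <= kermx (G *m D^T))%MS.
Proof.
move=> /submxP[W ->] zE; apply/sub_kermxP.
by rewrite trmx_mul !mulmxA -(mulmxA z) zE mul0mx.
Qed.

End OrthogonalProjection.

Section OrthogonalSections.
Context (R : realType) (n : nat) (N : manifold R n).

(** The complement is a kernel and comes without a local frame. A field constant in a chart is
    therefore projected off a frame of [D] and then cut off; at [x] the projection leaves [z]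
    unchanged, as [z] is already orthogonal to [D x]. *)
Lemma orth_section_through (G D : N -> 'M[R]_n) (x : N) (z : 'rV[R]_n) :
  smooth_form G -> (forall y, posdef (G y)) -> tangent_distribution D ->
  (z <= kermx (G x *m (D x)^T))%MS ->
  exists2 X, section_of (fun y => kermx (G y *m (D y)^T)) X & X x = z.
Proof.
move=> sG pG tD zD; have [k [U0 [E [oU0 U0x sE ED]]]] := tD x.
have ix := chart_atP x; set i := chart_at x in ix.
pose U := U0 `&` dom i.
have oU : open U by apply: openI => //; exact: dom_open.
have Ux : U x by split.
have uE y : U0 y -> E y *m G y *m (E y)^T \in unitmx.
  by move=> Uy; apply: posdef_unitmx; apply: posdef_gram; have [] := ED y Uy.
pose Z y := z *m of_chart i y.
pose Y y := orth_proj (G y) (E y) (Z y).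
have sY : smooth_field_on U Y.
  move=> j l; have oO := @open_chart_image _ _ N j U oU.
  have CG : Ck_on l (chart j @` (dom j `&` U)) (form_in j G).
    by apply: Ck_onS (sG j l) => q /chart_imageE[].
  have CE : Ck_on l (chart j @` (dom j `&` U)) (field_in j E).
    by apply: Ck_onS (sE j l) => q [y [jy [Uy _]] <-]; exists y.
  have CZ : Ck_on l (chart j @` (dom j `&` U)) (field_in j Z).
    by apply: Ck_onS (smooth_const_field i z j l) => q [y [jy [_ iy]] <-]; exists y.
  have YE q : (chart j @` (dom j `&` U)) q -> field_in j Y q =
      orth_proj (form_in j G q) (field_in j E q) (field_in j Z q).
    move=> /chart_imageE[qj _].
    exact: orth_proj_basis (to_of_chart (dom_param qj)).
  apply: (Ck_on_eq (f := fun q =>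
    orth_proj (form_in j G q) (field_in j E q) (field_in j Z q)) oO).
    by move=> q; rewrite inE => /YE ->.
  have CEt := Ck_on_trmx oO CE.
  have CZG := Ck_on_mulmx oO (Ck_on_mulmx oO CZ CG) CEt.
  have CEG := Ck_on_mulmx oO (Ck_on_mulmx oO CE CG) CEt.
  have CI : Ck_on l (chart j @` (dom j `&` U)) (fun q =>
      invmx (field_in j E q *m form_in j G q *m (field_in j E q)^T)).
    apply: (Ck_on_invmx oO _ CEG) => q /chart_imageE[qj [Uq _]].
    rewrite /field_in /form_in.
    have CO := to_of_chart (dom_param qj).
    apply: posdef_unitmx; apply: posdef_gram.
      move=> u u0; rewrite ip_mulmx; apply: pG.
      apply: contra u0 => /eqP uO; apply/eqP.
      have := congr1 (mulmx^~ (to_chart j (param j q))) uO.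
      rewrite -mulmxA mul0mx => <-.
      exact: esym (etrans (congr1 (mulmx u) (of_to_chart (dom_param qj))) (mulmx1 u)).
    have [fE _] := ED _ Uq; have [uC _] := mulmx1_unit CO.
    by rewrite /row_free mxrankMfree // row_free_unit.
  exact: (Ck_onD oO CZ (Ck_onN oO (Ck_on_mulmx oO (Ck_on_mulmx oO CZG CI) CE))).
have [X [sX Xx XE]] := extend_field oU Ux sY.
have [_ /eqmxP Ex] := ED x U0x.
exists X; last first.
  rewrite Xx /Y /Z of_chart_at mulmx1 orth_proj_id //.
  have /submxP[W ->] : (E x <= D x)%MS by rewrite Ex.
  by rewrite trmx_mul !mulmxA -(mulmxA z) (sub_kermxP zD) mul0mx.
split=> // y; have [c -> [[Uy _]|->]] := XE y; last by rewrite scale0r sub0mx.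
have [_ /eqmxP Ey] := ED y Uy.
rewrite scalemx_sub //; apply: (@kermx_sub_orth _ _ _ _ _ (E y)).
  by rewrite Ey.
exact/orth_proj_orthogonal/uE.
Qed.

End OrthogonalSections.

(** * Semi-invariant submanifolds *)

Section SemiInvariant.
Context (R : realType) (m n : nat) (M : manifold R m) (N : manifold R n).
Context (mu : R) (g F : M -> 'M[R]_m) (nablaM : connection M).
Context (f : N -> M) (nablaN : connection N) (D : N -> 'M[R]_n).
Context (hmu : mu = 1 \/ mu = -1) (hM : gFmu_manifold mu g F)
  (hF : nondegenerate_endo F) (hnablaM : levi_civita g nablaM)
  (hpar : parallel_endo nablaM F) (hf : immersion f)
  (hnablaN : levi_civita (induced_metric f g) nablaN)
  (hD : semi_invariant f g F D).
Implicit Types (X Y Z : N -> 'rV[R]_n) (V : N -> 'rV[R]_m) (x : N).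

Let fS : smooth_map f. Proof. by case: hf. Qed.
Let gR : riemannian_metric g. Proof. by case: hM. Qed.
Let fI : forall x, row_free (differential f x). Proof. by case: hf. Qed.
Let G := induced_metric f g.
Let Dp := Dperp f g D.
Let h := second_fundamental_form f nablaM nablaN.

Let gsym y u v : ip (g y) u v = ip (g y) v u.
Proof. by have [_ + _] := gR; apply. Qed.

Let ipG x u v :
  ip (G x) u v = ip (g (f x)) (u *m differential f x) (v *m differential f x).
Proof. exact: ip_mulmx. Qed.

Let sG : smooth_form G. Proof. exact: smooth_form_induced. Qed.

(** True by the definition of [h] as a difference; the geometric content, that [h] is normal, is
    [second_fundamental_form_normal]. *)
Lemma gauss_formula X Y x :
  cov_along f nablaM X (push f Y) x = h X Y x + push f (cov nablaN X Y) x.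
Proof. by rewrite /h /second_fundamental_form subrK. Qed.

Lemma second_fundamental_form_sym X Y x : smooth_field X -> smooth_field Y ->
  h X Y x = h Y X x.
Proof.
move=> sX sY; have [tM _] := hnablaM; have [tN _] := hnablaN.
have := torsion_along fS x tM tN sX sY; rewrite !gauss_formula {3}/push mulmxBl.
move: (h X Y x) (h Y X x) => a b; rewrite /push; set c := _ *m _; set d := _ *m _.
rewrite opprD addrACA => E; apply/eqP; rewrite -subr_eq0.
by rewrite -[a - b](addrK (c - d)) E subrr.
Qed.

(** The derivative along X of the function g(Y, Z) on [N] is computed twice, with the connection of
    [M] along [f] and with that of [N]; the two results differ exactly by the terms in [h]. *)
Lemma second_fundamental_form_skew X Y Z x :
  smooth_field X -> smooth_field Y -> smooth_field Z ->
  ip (g (f x)) (h X Y x) (push f Z x) = - ip (g (f x)) (h X Z x) (push f Y x).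
Proof.
move=> sX sY sZ; have [_ mM] := hnablaM; have [_ mN] := hnablaN.
have [sg _ _] := gR.
have E1 := metric_along fS X x sg mM (smooth_push fS sY) (smooth_push fS sZ).
have E2 := metric_along (@smooth_id _ _ N) X x sG mN
  ((smooth_along_id Y).1 sY) ((smooth_along_id Z).1 sZ).
have EE := etrans (esym E1) (etrans (eq_derive _ _ (fun q => esym (ipG _ _ _))) E2).
have A : ip (g (f x)) (h X Y x + push f (cov nablaN X Y) x) (push f Z x) +
    ip (g (f x)) (push f Y x) (h X Z x + push f (cov nablaN X Z) x) =
    ip (g (f x)) (push f (cov nablaN X Y) x) (push f Z x) +
    ip (g (f x)) (push f Y x) (push f (cov nablaN X Z) x).
  rewrite -!gauss_formula; apply: etrans EE _; rewrite -!cov_id.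
  by congr (_ + _); exact: ipG.
move: A; move: (h X Y x) (h X Z x) (push f Y x) (push f Z x).
move: (push f (cov nablaN X Y) x) (push f (cov nablaN X Z) x).
move=> c d a b u v; rewrite (gsym _ b) ipDl ipDr.
move: (ip _ a v) (ip _ u b) (ip _ c v) (ip _ u d) => r1 r2 r3 r4; lra.
Qed.

Lemma second_fundamental_form_normal_ip X Y Z x :
  smooth_field X -> smooth_field Y -> smooth_field Z ->
  ip (g (f x)) (h X Y x) (push f Z x) = 0.
Proof.
move=> sX sY sZ.
have e1 := second_fundamental_form_skew x sX sY sZ.
have e2 := second_fundamental_form_skew x sY sZ sX.
have e3 := second_fundamental_form_skew x sZ sX sY.
(* For a = g(h(X,Y),Z), b = g(h(X,Z),Y), c = g(h(Y,Z),X) the symmetry of [h] turns the three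
   relations into a = -b, c = -a, b = -c, which force a = 0. *)
rewrite (second_fundamental_form_sym x sZ sX) in e3.
rewrite (second_fundamental_form_sym x sY sX) in e2.
rewrite (second_fundamental_form_sym x sZ sY) in e3.
lra.
Qed.

Lemma second_fundamental_form_normal X Y x :
  smooth_field X -> smooth_field Y -> (h X Y x <= normal_bundle f g x)%MS.
Proof.
move=> sX sY; apply/sub_kermx_ip => w /submxP[z ->].
have [Z sZ <-] := field_through x z.
exact: second_fundamental_form_normal_ip.
Qed.

Lemma normal_ip x (v : 'rV[R]_m) (z : 'rV[R]_n) : (v <= normal_bundle f g x)%MS ->
  ip (g (f x)) v (z *m differential f x) = 0.
Proof. by move=> /sub_kermx_ip; apply; exact: submxMl. Qed.

Lemma F_Dperp_normal x (z : 'rV[R]_n) : (z <= Dp x)%MS ->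
  (z *m differential f x *m F (f x) <= normal_bundle f g x)%MS.
Proof.
move=> zD; have [_ _ Fn _] := hD; apply: submx_trans (Fn x).
by rewrite /F_image !submxMr.
Qed.

Lemma mul_F_image (E : N -> 'M[R]_n) x (c : 'rV[R]_n) :
  c *m F_image f F E x = c *m E x *m differential f x *m F (f x).
Proof. by rewrite /F_image !mulmxA. Qed.

(** The structure equation multiplied by [mu], which is its own inverse. *)
Lemma F_adjoint y u v : ip (g y) u (v *m F y) = - mu * ip (g y) (u *m F y) v.
Proof.
have [_ _ /(_ y u v)] := hM; case: hmu => -> E; lra.
Qed.

(** The relation g(X, FZ) = 0 is differentiated along Y, after h(X,Y) = h(Y,X) has made Y the
    direction of derivation. Here X is any tangent field, so the right-hand side keeps the full
    derivative in [M]; only once FX is tangent can it be replaced by the derivative in [N]. *)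
Lemma second_fundamental_form_F X Y Z x :
  smooth_field X -> section_of Dp Y -> section_of Dp Z ->
  ip (g (f x)) (h X Y x) (push f Z x *m F (f x)) =
  mu * ip (g (f x)) (push f X x *m F (f x)) (cov_along f nablaM Y (push f Z) x).
Proof.
move=> sX [sY YD] [sZ ZD]; have [_ mM] := hnablaM; have [sg _ _] := gR.
have [_ sF _] := hM.
have tangent_F y w : ip (g (f y)) (w *m differential f y) (push f Z y *m F (f y)) = 0.
  by rewrite gsym; apply: normal_ip; exact: F_Dperp_normal.
have sFZ := smooth_along_endo fS sF (smooth_push fS sZ).
have E := metric_along fS Y x sg mM (smooth_push fS sX) sFZ.
have E0 : 'D_(Y x) (fun q => ip (g (f (param (chart_at x) q)))
    (push f X (param (chart_at x) q))
    (push f Z (param (chart_at x) q) *m F (f (param (chart_at x) q))) : R^o)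
    (chart (chart_at x) x) = 0.
  apply: etrans (eq_derive (g := fun=> 0) _ _ _) (derive_cst _ _ _) => q.
  exact: tangent_F.
have := etrans (esym E0) E; rewrite gauss_formula ipDl tangent_F addr0.
rewrite (parallel_along fS Y x sF hpar (smooth_push fS sZ)).
rewrite (F_adjoint (f x) (push f X x)).
rewrite (second_fundamental_form_sym x sX sY).
move: (ip _ (h Y X x) _) (ip _ (push f X x *m _) _) => a b; lra.
Qed.

(** Invertibility of [F] preserves the rank, so the inclusion of F(D) in D is an equality. *)
Lemma F_image_D_eq x : (F_image f F D x :=: D x *m differential f x)%MS.
Proof.
have [_ /(_ x) FD _ _] := hD.
apply/eqmxP; rewrite -(geq_leqif (mxrank_leqif_eq FD)) /F_image.
by rewrite (mxrankMfree (D x *m _)) // row_free_unit; exact: hF.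
Qed.

(** Differentiate g(V, X) = 0 along Y. Pairing a tangential part with a tangent vector in the
    induced metric cancels the inverse Gram matrix in [tangential]. *)
Lemma weingarten_ip X Y V x : smooth_field X -> smooth_field Y ->
  smooth_along f V -> (forall y, (V y <= normal_bundle f g y)%MS) ->
  ip (G x) (weingarten f g nablaM V Y x) (X x) = ip (g (f x)) (h X Y x) (V x).
Proof.
move=> sX sY sV nV; have [_ mM] := hnablaM; have [sg _ _] := gR.
have E := metric_along fS Y x sg mM sV (smooth_push fS sX).
have E0 : 'D_(Y x) (fun q => ip (g (f (param (chart_at x) q)))
    (V (param (chart_at x) q)) (push f X (param (chart_at x) q)) : R^o)
    (chart (chart_at x) x) = 0.
  apply: etrans (eq_derive (g := fun=> 0) _ _ _) (derive_cst _ _ _) => q.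
  exact: normal_ip.
have := etrans (esym E0) E; rewrite gauss_formula ipDr (normal_ip _ (nV x)) addr0.
rewrite (second_fundamental_form_sym x sX sY) (gsym _ (V x)) => E1.
have uG := posdef_unitmx (induced_posdef gR fI x).
have -> : ip (G x) (weingarten f g nablaM V Y x) (X x) =
    - ip (g (f x)) (cov_along f nablaM Y V x) (push f X x).
  rewrite /weingarten ipNl; congr (- _).
  by rewrite /ip /tangential mulmxKV // /push trmx_mul !mulmxA.
by move: E1; move: (ip _ _ _) (ip _ _ _) => a b; lra.
Qed.

Lemma smooth_weingarten Y V : smooth_field Y -> smooth_along f V ->
  smooth_field (weingarten f g nablaM V Y).
Proof.
move=> sY sV i k; have oA := @open_chart_image _ _ N i setT openT.
have sT := smooth_tangential fS gR fI (smooth_cov_along fS nablaM sY sV) i k.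
apply: Ck_on_eq (Ck_onN oA sT) => // p _.
by rewrite /field_in /weingarten mulNmx.
Qed.

Lemma smooth_second_fundamental_form X Y : smooth_field X -> smooth_field Y ->
  smooth_along f (h X Y).
Proof.
move=> sX sY; apply: smooth_alongB => //.
  by apply: smooth_cov_along => //; exact: smooth_push.
by apply: smooth_push => //; exact: smooth_cov.
Qed.

Lemma Dp_section_through x (z : 'rV[R]_n) : (z <= Dp x)%MS ->
  exists2 Z, section_of Dp Z & Z x = z.
Proof.
have [tD _ _ _] := hD.
exact: (orth_section_through sG (induced_posdef gR fI) tD).
Qed.

Lemma Dp_ip x (u : 'rV[R]_n) : (u <= Dp x)%MS <->
  forall w : 'rV[R]_n, (w <= D x)%MS -> ip (G x) u w = 0.
Proof. exact: sub_kermx_ip. Qed.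

(** As [h] is normal, membership in [Dtilde] reduces to orthogonality to F(D^perp). *)
Lemma Dtilde_ip X Y x : smooth_field X -> smooth_field Y ->
  (h X Y x <= Dtilde f g F D x)%MS <-> forall z : 'rV[R]_n, (z <= Dp x)%MS ->
    ip (g (f x)) (h X Y x) (z *m differential f x *m F (f x)) = 0.
Proof.
move=> sX sY; rewrite /Dtilde sub_capmx second_fundamental_form_normal //=.
split=> [/sub_kermx_ip H z zD|H].
  by apply: H; rewrite /F_image !submxMr.
apply/sub_kermx_ip => w /submxP[c ->]; rewrite (mul_F_image Dp).
by apply: H; exact: submxMl.
Qed.

Lemma geodesic_iff_mixed :
  (forall Y Z, section_of Dp Y -> section_of Dp Z ->
    section_of Dp (cov nablaN Y Z)) <->
  (forall X Y, section_of D X -> section_of Dp Y ->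
    section_along f (Dtilde f g F D) (h X Y)).
Proof.
(* Against a tangent vector the normal part of the derivative in [M] is invisible. *)
have tangential_part (u : 'rV[R]_n) Y Z x : smooth_field Y -> smooth_field Z ->
    ip (g (f x)) (u *m differential f x) (cov_along f nablaM Y (push f Z) x) =
    ip (G x) (cov nablaN Y Z x) u.
  move=> sY sZ; rewrite gauss_formula ipDr gsym.
  rewrite (normal_ip _ (second_fundamental_form_normal x sY sZ)) add0r.
  by rewrite ipG gsym.
split=> [geo X Y [sX XD] DY|mixed Y Z DY DZ].
  have [sY YD] := DY; split=> [|x]; first exact: smooth_second_fundamental_form.
  apply/Dtilde_ip => // z zD; have [Z DZ <-] := Dp_section_through zD.
  have [sZ _] := DZ.
  apply: etrans (second_fundamental_form_F x sX DY DZ) _.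
  have [_ /(_ x) FD _ _] := hD.
  have /submxP[c cE] : (push f X x *m F (f x) <= D x *m differential f x)%MS.
    by apply: submx_trans FD; rewrite /F_image !submxMr.
  rewrite cE mulmxA tangential_part //; have [_ /(_ x)/Dp_ip->] := geo _ _ DY DZ.
    by rewrite mulr0.
  exact: submxMl.
have [sY YD] := DY; have [sZ ZD] := DZ.
split=> [|x]; first exact: smooth_cov.
apply/Dp_ip => w wD; have [tD _ _ _] := hD.
(* An arbitrary [w] in [D x] is written as F of the vector [c *m D x] of [D x]; a section X of [D]
   through that vector then satisfies FX = w at [x]. *)
have /submxP[c cE] : (w *m differential f x <= F_image f F D x)%MS.
  by rewrite F_image_D_eq submxMr.
have [X DX Xx] := section_through tD (submxMl c (D x)).
have [sX _] := DX.
have [_ /(_ x)/Dtilde_ip H] := mixed X Y DX DY.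
have := second_fundamental_form_F x sX DY DZ.
rewrite H // /push Xx.
have -> : c *m D x *m differential f x *m F (f x) = w *m differential f x.
  by rewrite cE (mul_F_image D).
rewrite tangential_part // => /esym/eqP; rewrite mulf_eq0 => /orP[|/eqP //].
by case: hmu => ->; rewrite ?oppr_eq0 oner_eq0.
Qed.

Lemma mixed_iff_invariant :
  (forall X Y, section_of D X -> section_of Dp Y ->
    section_along f (Dtilde f g F D) (h X Y)) <->
  (forall V Y, section_along f (F_image f F Dp) V -> section_of Dp Y ->
    section_of Dp (weingarten f g nablaM V Y)).
Proof.
have [tD _ Fnormal _] := hD; have [_ sF _] := hM.
split=> [mixed V Y [sV VF] DY|inv X Y [sX XD] DY]; have [sY YD] := DY.
  split=> [|x]; first exact: smooth_weingarten.
  apply/Dp_ip => w wD; have [X DX <-] := section_through tD wD.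
  have [sX _] := DX.
  have nV y : (V y <= normal_bundle f g y)%MS.
    exact: submx_trans (VF y) (Fnormal y).
  rewrite (weingarten_ip x sX sY sV nV).
  have [_ /(_ x)/Dtilde_ip H] := mixed X Y DX DY.
  (* At the single point [x], V is F of the vector [c *m Dp x], and the pointwise form of
     [Dtilde_ip] accepts this vector without a section through it. *)
  have /submxP[c ->] := VF x.
  by rewrite (mul_F_image Dp) H // submxMl.
split=> [|x]; first exact: smooth_second_fundamental_form.
apply/Dtilde_ip => // z zD; have [Z [sZ ZD] <-] := Dp_section_through zD.
(* The invariance is tested on V = FZ, with Z a section of D^perp through the given vector [z]. *)
pose V y := push f Z y *m F (f y).
have sV : smooth_along f V := smooth_along_endo fS sF (smooth_push fS sZ).
have VF y : (V y <= F_image f F Dp y)%MS by rewrite /F_image !submxMr.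
have nV y : (V y <= normal_bundle f g y)%MS.
  exact: submx_trans (VF y) (Fnormal y).
apply: etrans (esym (weingarten_ip x sX sY sV nV)) _.
by have [_ /(_ x)/Dp_ip H] := inv V Y (conj sV VF) DY; exact: H.
Qed.

End SemiInvariant.

Theorem theorem4p8 (R : realType) (m n : nat)
    (M : manifold R m) (N : manifold R n)
    (mu : R) (g F : M -> 'M[R]_m) (nablaM : connection M)
    (f : N -> M) (nablaN : connection N) (D : N -> 'M[R]_n)
    (hmu : mu = 1 \/ mu = -1)
    (hM : gFmu_manifold mu g F)
    (hF : nondegenerate_endo F)
    (hnablaM : levi_civita g nablaM)
    (hpar : parallel_endo nablaM F)
    (hf : immersion f)
    (hnablaN : levi_civita (induced_metric f g) nablaN)
    (hD : semi_invariant f g F D) :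
  let Dp := Dperp f g D in
  let geodesic := forall Y Z : N -> 'rV[R]_n,
    section_of Dp Y -> section_of Dp Z -> section_of Dp (cov nablaN Y Z) in
  let mixed := forall X Y : N -> 'rV[R]_n,
    section_of D X -> section_of Dp Y ->
    section_along f (Dtilde f g F D)
      (second_fundamental_form f nablaM nablaN X Y) in
  let invariant := forall (V : N -> 'rV[R]_m) (Y : N -> 'rV[R]_n),
    section_along f (F_image f F Dp) V -> section_of Dp Y ->
    section_of Dp (weingarten f g nablaM V Y) in
  (geodesic <-> mixed) /\ (mixed <-> invariant).
Proof.
move=> Dp geodesic mixed invariant; split.
  exact: (geodesic_iff_mixed hmu hM hF hnablaM hpar hf hnablaN hD).
exact: (mixed_iff_invariant hM hnablaM hf hnablaN hD).
Qed.
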